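(* For real $t$ put $\mathfrak m(it)=\int_0^1 e^{ixt}\,\mathrm d ?(x)$, where $?$ is the Minkowski question mark function on $[0,1]$. Then, as $|t|\to\infty$, $$|\mathfrak m(it)|\ll |t|^{-1/35},$$ that is, there are constants $C,T_0>0$ such that $|\mathfrak m(it)|\le C|t|^{-1/35}$ for all real $t$ with $|t|\ge T_0$.
   Context: The Minkowski question mark function $?:[0,1]\to[0,1]$ is the continuous increasing function defined by $?(0)=0$ and, using the continued fraction $x=[0,a_1,a_2,\ldots]=\cfrac{1}{a_1+\cfrac{1}{a_2+\cdots}}$ with $a_j\in\mathbb N=\{1,2,\ldots\}$, by $$?([0,a_1,a_2,\ldots])=2\sum_{j\ge1}(-1)^{j+1}2^{-(a_1+\cdots+a_j)}$$ (for rational $x$ the continued fraction and the sum are finite). The integral $\int\cdot\,\mathrm d?(x)$ is the Lebesgue–Stieltjes integral, i.e. the integral against the Borel probability measure on $[0,1]$ with distribution function $?$. *)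

(* Defs.v *)
From HB Require Import structures.
From mathcomp Require Import all_boot all_order all_algebra.
From mathcomp Require Import all_classical all_reals all_analysis.
From mathcomp.real_closed Require Import complex.
From mathcomp Require Import ring lra.

Set Implicit Arguments.
Unset Strict Implicit.
Unset Printing Implicit Defensive.

Import Order.TTheory GRing.Theory Num.Theory.
Import numFieldNormedType.Exports.

Local Open Scope classical_set_scope.
Local Open Scope ring_scope.

Section minkowski.
Context {R : realType}.
Implicit Types (x y z : R) (j k n : nat).

(* The Gauss map x |-> 1/x - floor(1/x). Since 0^-1 = 0, it fixes 0. *)
Definition gauss x : R := x^-1 - (Num.truncn x^-1)%:R.

(* The partial quotient a_(j+1) in x = [0, a_1, a_2, ...]. The expansion stops
   at the first j with iter j gauss x = 0; all further values are junk 0s.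
   For rational x in (0, 1) this is the finite expansion whose last partial
   quotient is > 1, while 1 = [0, 1]; the other finite expansion of x gives the
   same value of minkowski below. *)
Definition cf_digit x j : nat := Num.truncn (iter j gauss x)^-1.

Lemma cf_digitE x n :
  x = foldr (fun (a : nat) y => (a%:R + y)^-1) (iter n gauss x)
        [seq cf_digit x j | j <- iota 0 n].
Proof.
have gE y : y = ((Num.truncn y^-1)%:R + gauss y)^-1.
  by rewrite /gauss addrCA subrr addr0 invrK.
elim: n x => [//|n IH] x; rewrite [LHS]gE/= {1}/cf_digit/=.
congr ((_ + _)^-1); rewrite [LHS]IH -iterSr iterS (iotaDl 1 0) -map_comp.
congr foldr; apply: eq_map => j /=.
by rewrite /cf_digit -iterSr.
Qed.

Definition minkowski_term x j : R :=
  if iter j gauss x == 0 then 0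
  else (-1) ^+ j / 2 ^+ (\sum_(i < j.+1) cf_digit x i).

(* The index j starts at 0, whence the sign (-1)^j for the term in
   2^-(a_1 + ... + a_(j+1)). *)
Definition minkowski x : R := 2 * limn (series (minkowski_term x)).

Lemma gauss0 : gauss 0 = 0.
Proof. by rewrite /gauss invr0 truncn0 subrr. Qed.

Lemma iter_gauss0 j : iter j gauss 0 = 0.
Proof. by elim: j => //= j ->; rewrite gauss0. Qed.

Lemma gauss_itv x : 0 <= x -> 0 <= gauss x < 1.
Proof.
rewrite -invr_ge0 => /truncn_itv/andP[h1 h2].
by rewrite /gauss subr_ge0 h1 ltrBlDl -(natrD _ _ 1) addn1.
Qed.

Lemma digit_gt0 x : 0 < x <= 1 -> (0 < Num.truncn x^-1)%N.
Proof. by move=> /andP[x0 x1]; rewrite truncn_gt0 invf_ge1. Qed.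

Lemma termS x j : x != 0 ->
  minkowski_term x j.+1 =
  - (2 ^+ Num.truncn x^-1)^-1 * minkowski_term (gauss x) j.
Proof.
move=> x0; rewrite /minkowski_term iterSr; case: ifPn => _; first by rewrite mulr0.
rewrite exprS big_ord_recl (exprD 2) invfM.
rewrite (_ : cf_digit x ord0 = Num.truncn x^-1)//.
under eq_bigr => i _.
  rewrite (_ : cf_digit x (lift ord0 i) = cf_digit (gauss x) i); last first.
    by rewrite /cf_digit lift0 iterSr.
  over.
by rewrite mulN1r !mulNr mulrCA.
Qed.

Lemma term0 j : minkowski_term 0 j = 0.
Proof. by rewrite /minkowski_term iter_gauss0 eqxx. Qed.

Lemma term_le x j : 0 <= x <= 1 -> `|minkowski_term x j| <= (2 ^+ j)^-1.
Proof.
elim: j x => [|j IH] x /andP[x0 x1].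
  rewrite /minkowski_term/=; case: ifP => _; first by rewrite normr0 expr0 invr1.
  rewrite expr0 invr1 mul1r ger0_norm ?invr_ge0 ?exprn_ge0//.
  by rewrite invf_le1 ?exprn_gt0// exprn_ege1// ler1n.
have [->|xn0] := eqVneq x 0; first by rewrite term0 normr0 invr_ge0 exprn_ge0.
have xp : 0 < x <= 1 by rewrite x1 lt_neqAle eq_sym xn0 x0.
have c0 n : 0 <= (2 ^+ n)^-1 :> R by rewrite invr_ge0 exprn_ge0.
rewrite termS// normrM normrN (ger0_norm (c0 _)) exprS invfM.
apply: ler_pM => //.
  rewrite lef_pV2 ?posrE ?exprn_gt0// -{1}(expr1 2).
  by rewrite ler_eXn2l ?ltr1n// digit_gt0.
by apply: IH; have /andP[-> /ltW->] := gauss_itv x0.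
Qed.

Lemma cvg_minkowski x : 0 <= x <= 1 -> cvgn (series (minkowski_term x)).
Proof.
move=> x01; apply: normed_cvg.
apply: (@series_le_cvg _ _ (geometric 1 (2^-1))) => [j|j|j|].
- exact: normr_ge0.
- by rewrite /= mul1r exprn_ge0// invr_ge0.
- by rewrite /= mul1r exprVn; exact: term_le.
- by apply: is_cvg_geometric_series; rewrite ger0_norm; lra.
Qed.

Lemma minkowski0 : minkowski 0 = 0.
Proof.
rewrite /minkowski (_ : series _ = cst 0) ?lim_cst ?mulr0//.
apply/funext => n; rewrite /series/= big1// => j _; exact: term0.
Qed.

Lemma minkowski_rec x : 0 < x <= 1 ->
  minkowski x = (2 ^+ Num.truncn x^-1)^-1 * (2 - minkowski (gauss x)).
Proof.
move=> /andP[x0 x1]; rewrite /minkowski.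
set c := (_ ^+ _)^-1; set l := limn (series (minkowski_term (gauss x))).
suff : series (minkowski_term x) @ \oo --> c * (1 - l).
  by move/cvg_lim => -> //; ring.
rewrite -(cvg_shiftS (series (minkowski_term x))).
have -> : [sequence series (minkowski_term x) n.+1]_n =
    (fun n => c * (1 - series (minkowski_term (gauss x)) n)).
  apply/funext => n /=; rewrite /series/= big_nat_recl//.
  rewrite mulrBr mulr1; congr (_ + _).
    rewrite /minkowski_term/= (gt_eqF x0) big_ord1 /cf_digit/=.
    by rewrite expr0 mul1r.
  rewrite big_distrr/= -sumrN; apply: eq_bigr => i _.
  by rewrite termS ?gt_eqF// mulNr.
apply: cvgM; first exact: cvg_cst.
apply: cvgB; first exact: cvg_cst.
apply: cvg_minkowski.
by have /andP[-> /ltW->] := gauss_itv (ltW x0).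
Qed.

Lemma minkowski_itv x : 0 <= x <= 1 -> 0 <= minkowski x <= 1.
Proof.
have partial n y : 0 <= y <= 1 ->
    0 <= series (minkowski_term y) n <= 2^-1.
  elim: n y => [|n IH] y /andP[y0 y1].
    by rewrite /series/= big_geq// lexx invr_ge0 ler0n.
  have [->|yn0] := eqVneq y 0.
    rewrite /series/= big1 ?lexx ?invr_ge0 ?ler0n// => j _; exact: term0.
  have yp : 0 < y <= 1 by rewrite y1 lt_neqAle eq_sym yn0 y0.
  have := IH (gauss y); have /andP[-> /ltW->] := gauss_itv y0.
  move=> /(_ isT) /andP[s0 s1].
  have -> : series (minkowski_term y) n.+1 =
      (2 ^+ Num.truncn y^-1)^-1 * (1 - series (minkowski_term (gauss y)) n).
    rewrite /series/= big_nat_recl// mulrBr mulr1; congr (_ + _).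
      rewrite /minkowski_term/= (negbTE yn0) big_ord1 /cf_digit/=.
      by rewrite expr0 mul1r.
    rewrite big_distrr/= -sumrN; apply: eq_bigr => i _.
    by rewrite termS// mulNr.
  set c := (_ ^+ _)^-1.
  have c0 : 0 <= c by rewrite invr_ge0 exprn_ge0.
  have c1 : c <= 2^-1.
    rewrite lef_pV2 ?posrE ?exprn_gt0// -{1}(expr1 2).
    by rewrite ler_eXn2l ?ltr1n// digit_gt0.
  set s := series _ _ in s0 s1 *.
  by apply/andP; split; nra.
move=> x01; have cx := cvg_minkowski x01.
have l0 : 0 <= limn (series (minkowski_term x)).
  apply: limr_ge => //; apply: nearW => n.
  by have /andP[] := partial n x x01.
have l1 : limn (series (minkowski_term x)) <= 2^-1.
  apply: limr_le => //; apply: nearW => n.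
  by have /andP[] := partial n x x01.
rewrite /minkowski; lra.
Qed.

Lemma minkowski1 : minkowski 1 = 1.
Proof.
rewrite minkowski_rec ?ltr01 ?lexx// /gauss invr1 truncn1 subrr minkowski0.
by rewrite expr1 subr0 mulVf.
Qed.

Lemma minkowski_rec_itv x k : (0 < k)%N -> k%:R <= x^-1 <= k.+1%:R ->
  minkowski x = (2 ^+ k)^-1 * (2 - minkowski (x^-1 - k%:R)).
Proof.
move=> k0 /andP[h1 h2].
have k1 : 1 <= k%:R :> R by rewrite ler1n.
have x0 : 0 < x by rewrite -invr_gt0; lra.
have x1 : x <= 1 by rewrite -invf_ge1//; lra.
rewrite minkowski_rec ?x0//.
move: h2; rewrite le_eqVlt => /predU1P[h2|h2]; last first.
  by rewrite /gauss (@truncn_def _ _ k) ?h1.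
rewrite /gauss h2 natrK subrr minkowski0 -(natr1 k) [_ + 1]addrC addrK minkowski1.
by rewrite exprS; field; rewrite expf_neq0.
Qed.

Lemma minkowski_homo x y : 0 <= x -> x <= y -> y <= 1 ->
  minkowski x <= minkowski y.
Proof.
move=> x0 xy y1.
suff H n : minkowski x - (2 ^+ n)^-1 <= minkowski y.
  have cv : (fun n => minkowski x - (2 ^+ n)^-1) @ \oo --> minkowski x - 0.
    apply: cvgB; first exact: cvg_cst.
    rewrite (_ : (fun n => _) = geometric 1 (2^-1)); last first.
      by apply/funext => n /=; rewrite mul1r exprVn.
    by apply: cvg_geometric; rewrite ger0_norm; lra.
  rewrite -[minkowski x]subr0 -(cvg_lim _ cv)//.
  by apply: limr_le; [exact: cvgP cv|exact: nearW].
elim: n x y x0 xy y1 => [|n IH] x y x0 xy y1.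
  have /andP[_ ?] : 0 <= minkowski x <= 1 by apply: minkowski_itv; lra.
  have /andP[? _] : 0 <= minkowski y <= 1 by apply: minkowski_itv; lra.
  by rewrite expr0 invr1; lra.
have c0 m : 0 < (2 ^+ m)^-1 :> R by rewrite invr_gt0 exprn_gt0.
have /andP[my _] : 0 <= minkowski y <= 1 by apply: minkowski_itv; lra.
have [x00|xn0] := eqVneq x 0.
  by rewrite x00 minkowski0; have := c0 n.+1; lra.
have xp : 0 < x by rewrite lt_neqAle eq_sym xn0 x0.
have yp : 0 < y by lra.
have /andP[gx0 gx1] := gauss_itv x0.
have /andP[gy0 gy1] := gauss_itv (ltW yp).
have /andP[? ?] : 0 <= minkowski (gauss x) <= 1 by apply: minkowski_itv; lra.
have /andP[? ?] : 0 <= minkowski (gauss y) <= 1 by apply: minkowski_itv; lra.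
rewrite (@minkowski_rec x) ?xp/=; last lra.
rewrite (@minkowski_rec y) ?yp/=; last lra.
have yx : y^-1 <= x^-1 by rewrite lef_pV2 ?posrE.
have := le_truncn yx; rewrite leq_eqVlt => /predU1P[e|lt].
  have := IH (gauss y) (gauss x) gy0; rewrite {1}/gauss {2}/gauss e.
  rewrite lerD2r => /(_ yx (ltW gx1)).
  have d1 : (2 ^+ Num.truncn x^-1)^-1 <= 2^-1 :> R.
    rewrite lef_pV2 ?posrE ?exprn_gt0// -{1}(expr1 2).
    by rewrite ler_eXn2l ?ltr1n// digit_gt0// xp; lra.
  have := c0 (Num.truncn x^-1); have := c0 n.
  rewrite exprS invfM.
  set c := (2 ^+ n)^-1; set d := (2 ^+ _)^-1 in d1 *.
  by move=> *; nra.
have : (2 ^+ Num.truncn x^-1)^-1 <= (2 ^+ (Num.truncn y^-1).+1)^-1 :> R.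
  by rewrite lef_pV2 ?posrE ?exprn_gt0// ler_eXn2l ?ltr1n.
have := c0 (Num.truncn x^-1); have := c0 (Num.truncn y^-1); have := c0 n.+1.
rewrite (exprS _ (Num.truncn y^-1)) invfM.
set c := (2 ^+ n.+1)^-1.
set d := (2 ^+ Num.truncn x^-1)^-1; set e := (2 ^+ Num.truncn y^-1)^-1.
by move=> *; nra.
Qed.

Lemma minkowski_invS n : minkowski (n.+1%:R^-1) = (2 ^+ n)^-1.
Proof.
rewrite (@minkowski_rec_itv _ n.+1)//; last first.
  by rewrite invrK lexx ler_nat leqnSn.
by rewrite invrK subrr minkowski0 exprS; field; rewrite expf_neq0.
Qed.

Lemma minkowski_near n :
  (forall x, 0 <= x < 1 ->
    exists y, x < y <= 1 /\ minkowski y <= minkowski x + (2 ^+ n)^-1) /\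
  (forall x, 0 < x <= 1 ->
    exists y, 0 <= y < x /\ minkowski x - (2 ^+ n)^-1 <= minkowski y).
Proof.
have c0 m : 0 < (2 ^+ m)^-1 :> R by rewrite invr_gt0 exprn_gt0.
have c1 m : (2 ^+ m)^-1 <= 1 :> R by rewrite invf_le1 ?exprn_gt0// exprn_ege1// ler1n.
elim: n => [|n [IHr IHl]].
  rewrite expr0 invr1; split => x /andP[x0 x1].
    exists 1; rewrite x1 lexx minkowski1; split => //.
    by have /andP[] : 0 <= minkowski x <= 1 by [apply: minkowski_itv; lra]; lra.
  exists 0; rewrite lexx x0 minkowski0; split => //.
  by have /andP[] : 0 <= minkowski x <= 1 by [apply: minkowski_itv; lra]; lra.
have half m (a b : R) : (0 < m)%N -> a - (2 ^+ n)^-1 <= b ->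
    (2 ^+ m)^-1 * (2 - b) <= (2 ^+ m)^-1 * (2 - a) + (2 ^+ n.+1)^-1.
  move=> m0 ab.
  have d1 : (2 ^+ m)^-1 <= 2^-1 :> R.
    by rewrite lef_pV2 ?posrE ?exprn_gt0// -{1}(expr1 2) ler_eXn2l ?ltr1n.
  have := c0 m; have := c0 n; rewrite exprS invfM.
  set c := (2 ^+ n)^-1 in ab *; set d := (2 ^+ _)^-1 in d1 *.
  by move=> *; nra.
split => x /andP[x0 x1].
- have [->|xn0] := eqVneq x 0.
    exists (n.+2%:R^-1); rewrite minkowski_invS minkowski0 add0r lexx.
    by rewrite invr_gt0 ltr0n invf_le1 ?ltr0n// ler1n.
  have xp : 0 < x by rewrite lt_neqAle eq_sym xn0 x0.
  have [k k0 /andP[kx xk]] :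
      exists2 k, (0 < k)%N & k%:R < x^-1 <= k.+1%:R.
    have x'1 : 1 < x^-1 by rewrite invf_gt1.
    have := truncn_itv (ltW (lt_trans ltr01 x'1)).
    set a := Num.truncn _ => /andP[ax xa].
    move: ax; rewrite le_eqVlt => /predU1P[ax|ax]; last first.
      exists a; last by rewrite ax ltW.
      by rewrite truncn_gt0 ltW.
    move: ax x'1; case: a {xa} => [|[|a]] <-.
    + by rewrite ltr10.
    + by rewrite ltxx.
    + by move=> _; exists a.+1 => //; rewrite ltr_nat ltnSn lexx.
  have [|z [/andP[z0 zx] Hz]] := IHl (x^-1 - k%:R).
    by rewrite subr_gt0 kx lerBlDl -(natrD _ _ 1) addn1.
  have kp : 0 < k%:R :> R by rewrite ltr0n.
  have k1 : 1 <= k%:R :> R by rewrite ler1n.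
  exists (k%:R + z)^-1; split.
    apply/andP; split.
      by rewrite -[ltLHS]invrK ltf_pV2 ?posrE ?invr_gt0//; lra.
    by rewrite invf_le1; lra.
  rewrite (@minkowski_rec_itv x k) ?(ltW kx)//.
  rewrite (@minkowski_rec_itv (k%:R + z)^-1 k)//; last first.
    by rewrite invrK -natr1; move: xk; rewrite -natr1 => xk; lra.
  by rewrite invrK [_ + z]addrC addrK; exact: half.
- have xp : 0 < x <= 1 by rewrite x0.
  have x'0 : 0 <= x^-1 by rewrite invr_ge0 ltW.
  have k0 := digit_gt0 xp; have /andP[kx xk] := truncn_itv x'0.
  move: k0 kx xk; set k := Num.truncn _ => k0 kx xk.
  have [|z [/andP[zx z1] Hz]] := IHr (x^-1 - k%:R).
    by rewrite subr_ge0 kx ltrBlDl -(natrD _ _ 1) addn1.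
  have k1 : 1 <= k%:R :> R by rewrite ler1n.
  exists (k%:R + z)^-1; split.
    apply/andP; split; first by rewrite invr_ge0; lra.
    by rewrite -[ltRHS]invrK ltf_pV2 ?posrE ?invr_gt0//; lra.
  rewrite (@minkowski_rec_itv x k) ?kx ?(ltW xk)//.
  rewrite (@minkowski_rec_itv (k%:R + z)^-1 k)//; last first.
    by rewrite invrK -natr1; move: xk; rewrite -natr1 => xk; lra.
  rewrite invrK [_ + z]addrC addrK lerBlDr; apply: half => //; lra.
Qed.

(* The distribution function on the whole line: ? on [0, 1], constant outside. *)
Definition minkowski_cdf x : R := minkowski (Num.max 0 (Num.min x 1)).

Lemma minkowski_cdf0 x : x <= 0 -> minkowski_cdf x = 0.
Proof.
move=> x0; rewrite /minkowski_cdf min_l; last lra.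
by rewrite max_l// minkowski0.
Qed.

Lemma minkowski_cdf1 x : 1 <= x -> minkowski_cdf x = 1.
Proof.
by move=> x1; rewrite /minkowski_cdf min_r// max_r ?ler01// minkowski1.
Qed.

Lemma minkowski_cdfE x : 0 <= x <= 1 -> minkowski_cdf x = minkowski x.
Proof. by move=> /andP[x0 x1]; rewrite /minkowski_cdf min_l// max_r. Qed.

Lemma minkowski_cdf_nd : nondecreasing minkowski_cdf.
Proof.
move=> x y xy; apply: minkowski_homo.
- by rewrite le_max lexx.
- by rewrite ge_max !le_max lexx/= le_min !ge_min xy lexx !orbT.
- by rewrite ge_max ler01 ge_min lexx orbT.
Qed.

Lemma minkowski_cdf_rc : right_continuous minkowski_cdf.
Proof.
move=> x; apply/cvgrPdist_le => /= e e0.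
have [n ne] : exists n, (2 ^+ n)^-1 <= e.
  have : geometric 1 (2^-1) @ \oo --> (0 : R).
    by apply: cvg_geometric; rewrite ger0_norm; lra.
  move=> /cvgrPdist_le /(_ _ e0) [n _ /(_ n (leqnn n))] /=.
  rewrite sub0r normrN mul1r exprVn ger0_norm ?invr_ge0 ?exprn_ge0//.
  by exists n.
have [y [xy Hy]] : exists y, x < y /\
    minkowski_cdf y <= minkowski_cdf x + (2 ^+ n)^-1.
  have c0 : 0 <= (2 ^+ n)^-1 :> R by rewrite invr_ge0 exprn_ge0.
  have [x0|x0] := ltP x 0.
    by exists 0; split => //; rewrite !minkowski_cdf0 ?lexx ?ltW// add0r.
  have [x1|x1] := leP 1 x.
    exists (x + 1); split; first by rewrite ltrDl.
    by rewrite !minkowski_cdf1 ?lerDl//; lra.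
  have [+ _] := minkowski_near n.
  move=> /(_ x); rewrite x0 x1 => /(_ isT) [y [/andP[xy y1] Hy]].
  exists y; split => //; rewrite !minkowski_cdfE ?x0 ?(ltW x1)//.
  by rewrite y1 (le_trans x0 (ltW xy)).
near=> z.
have xz : x <= z by near: z; exact: nbhs_right_ge.
have zy : z <= y by near: z; exact: nbhs_right_le.
have h1 := minkowski_cdf_nd xz; have h2 := minkowski_cdf_nd zy.
by rewrite distrC ger0_norm; lra.
Unshelve. all: by end_near. Qed.

HB.instance Definition _ := isCumulative.Build R _ R minkowski_cdf
  minkowski_cdf_nd minkowski_cdf_rc.

Lemma minkowski_cdf_cvgNy : minkowski_cdf @ -oo --> (0 : R).
Proof.
apply: cvg_near_cst; near=> x; apply: minkowski_cdf0.
by near: x; exact: nbhs_ninfty_le.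
Unshelve. all: by end_near. Qed.

Lemma minkowski_cdf_cvgy : minkowski_cdf @ +oo --> (1 : R).
Proof.
apply: cvg_near_cst; near=> x; apply: minkowski_cdf1.
by near: x; exact: nbhs_pinfty_ge.
Unshelve. all: by end_near. Qed.

HB.instance Definition _ := isCumulativeBounded.Build R 0 1 minkowski_cdf
  minkowski_cdf_cvgNy minkowski_cdf_cvgy.

End minkowski.

Section complex_integral.
Local Open Scope complex_scope.

Definition Cintegral (d : measure_display) (T : measurableType d) (R : realType)
    (mu : {measure set T -> \bar R}) (D : set T) (f : T -> R[i]) : R[i] :=
  Complex (\int[mu]_(x in D) complex.Re (f x))
          (\int[mu]_(x in D) complex.Im (f x)).

Definition expi (R : realType) (x : R) : R[i] := cos x +i* sin x.

(* The value at the purely imaginary point it of z |-> int_0^1 e^(xz) d?(x). *)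
Definition minkowski_m (R : realType) (t : R) : R[i] :=
  Cintegral (lebesgue_stieltjes_measure (@minkowski_cdf R)) `[0, 1]
    (fun x : R => expi (x * t)).

End complex_integral.

(* Main.v *)
Require Import Defs.
From mathcomp Require Import all_boot all_order all_algebra.
From mathcomp Require Import all_classical all_reals all_analysis.
From mathcomp.real_closed Require Import complex.
From mathcomp Require Import ring lra zify.

Set Implicit Arguments.
Unset Strict Implicit.
Unset Printing Implicit Defensive.

Import Order.TTheory GRing.Theory Num.Theory.
Import numFieldNormedType.Exports.
Local Open Scope ring_scope.

(* The measure is invariant under choosing one of the branches x/(1+x) and
   1/(1+x) with probability 1/2 each. Put t = 2^(35 j) up to a bounded factor.
   Stop the resulting random products at the first time that the bottom row
   (c, d) satisfies c + d >= 2^(7 j); this writes the Fourier transform as the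
   integral of F = sum_w p_w e^(i t w), and by Cauchy-Schwarz it suffices to
   bound the integral of |F|^2. On [1/L, 1] with L = 2 j + 1 the phases have
   derivative of size at most about 2^(21 j), so Gallagher's inequality on the
   cylinders of depth 15 j, which have mass 2^(-15 j) and length at least about
   2^(-21 j), compares this integral with a Lebesgue integral of
   |F|^2 + 2^(-42 j) |F'|^2. Expanding the square leaves oscillatory
   integrals with phase t (w - v), w' - v' = +-(1/(c x + d)^2 - 1/(c' x + d')^2),
   which are estimated by integration by parts, while the pairs with (c', d')
   close to (c, d) are few because (c, d) and the orientation determine w.
   The remaining part [0, 1/L] has mass 2^(-2 j).

   Lebesgue integrals are replaced by increments of explicit antiderivatives,
   and the invariant measure by the uniform measures on the 2^n points
   w(0), |w| = n, with n -> oo at the end. *)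

(** * Words in the two inverse branches *)

Section words.
Context {R : realType}.
Implicit Types (x y : R) (u v : seq bool) (f g : R -> R).

(* A word is a composition of the two inverse branches x/(1+x) (letter [false])
   and 1/(1+x) (letter [true]); its head is the innermost, i.e. first applied,
   branch. *)
Definition branch (l : bool) x : R := if l then (1 + x)^-1 else x / (1 + x).

Fixpoint mob u x : R := if u is l :: u' then mob u' (branch l x) else x.

(* The bottom row (c, d) of the matrix of [mob u]. *)
Fixpoint brow u : nat * nat :=
  if u is l :: u' then
    let: (c, d) := brow u' in if l then (d, c + d)%N else (c + d, d)%N
  else (0, 1)%N.

Definition den u : nat := ((brow u).1 + (brow u).2)%N.

(** [true] means that [mob u] reverses order; [(-1) ^+ orient u] is the determinant of its
    matrix. *)
Fixpoint orient u : bool := if u is l :: u' then l (+) orient u' else false.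

Definition lin u x : R := (brow u).1%:R * x + (brow u).2%:R.

Lemma branch_itv l x : 0 <= x <= 1 -> 0 <= branch l x <= 1.
Proof.
move=> /andP[x0 x1]; have h : 0 < 1 + x by lra.
case: l => /=.
  by rewrite invr_ge0 (ltW h) invf_le1//; lra.
by rewrite divr_ge0 ?(ltW h)//= ler_pdivrMr//; lra.
Qed.

Lemma branch_ge0 l x : 0 <= x -> 0 <= branch l x.
Proof.
by move=> x0; case: l => /=; rewrite ?invr_ge0 ?divr_ge0//; rewrite addr_ge0.
Qed.

Lemma mob_itv u x : 0 <= x <= 1 -> 0 <= mob u x <= 1.
Proof. by elim: u x => //= l u IH x x01; apply/IH/branch_itv. Qed.

Lemma brow2_gt0 u : (0 < (brow u).2)%N.
Proof.
elim: u => //= l u; case: (brow u) => c d /= d0.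
by case: l => //=; rewrite addn_gt0 d0 orbT.
Qed.

Lemma lin_gt0 u x : 0 <= x -> 0 < lin u x.
Proof.
by move=> x0; rewrite /lin ltr_wpDl ?mulr_ge0// ltr0n brow2_gt0.
Qed.

Lemma lin_cons l u x : 0 <= x ->
  lin (l :: u) x = (1 + x) * lin u (branch l x).
Proof.
move=> x0; have h : 1 + x != 0 by apply: lt0r_neq0; lra.
rewrite /lin /=; case: (brow u) => c d; case: l => /=; rewrite natrD; field => //.
Qed.

(** The matrix of [mob u] has determinant [(-1) ^+ orient u], and [lin u] is the denominator of
    [mob u]. Cylinder lengths and monotonicity are read off from this identity. *)
Lemma mobB u x y : 0 <= x -> 0 <= y ->
  mob u x - mob u y = (-1) ^+ orient u * (x - y) / (lin u x * lin u y).
Proof.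
elim: u x y => [|l u IH] x y x0 y0.
  by rewrite /= /lin /= !mul0r !add0r expr0; field.
have hx : 1 + x != 0 by apply: lt0r_neq0; lra.
have hy : 1 + y != 0 by apply: lt0r_neq0; lra.
have bx := branch_ge0 l x0; have by' := branch_ge0 l y0.
have := lt0r_neq0 (lin_gt0 u bx); have := lt0r_neq0 (lin_gt0 u by').
rewrite /= IH// !lin_cons//.
set lx := lin u _; set ly := lin u _ => ly0 lx0.
rewrite signr_addb; case: l {IH bx by'} @lx @ly ly0 lx0 => lx ly ly0 lx0 /=.
  by rewrite expr1; field; rewrite ly0 lx0 hx hy.
by rewrite expr0; field; rewrite ly0 lx0 hx hy.
Qed.

(** Subtractive Euclidean algorithm: comparing the two entries of the row recovers the head letter,
    and subtracting recovers the row of the tail. The only tie in a nonempty word is the row (1, 1)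
    of the two one-letter words, and there [orient] decides. *)
Lemma orient_brow_inj u v : orient u = orient v -> brow u = brow v -> u = v.
Proof.
have row_nil w : (brow w).1 = 0%N -> w = [::].
  case: w => //= l w; have := brow2_gt0 w; case: (brow w) => c d /=.
  by case: l => /=; lia.
elim: u v => [|l u IH] v.
  by move=> _ h; rewrite (row_nil v)// -h.
case: v => [_ h|k v]; first by rewrite (row_nil (l :: u))// h.
move=> /= + h; have := brow2_gt0 u; have := brow2_gt0 v.
have := row_nil u; have := row_nil v; have := IH v.
move: h; case: (brow u) => c d; case: (brow v) => c' d' /=.
case: l k => [] [] /= + IHv n1 n2 d0 d0' o.
- move=> [? ?]; rewrite IHv//; first by move: o; do 2!case: orient.
  congr pair; lia.
(* Different head letters force the tie: both tails have first entry 0, hence are empty, and the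
   orientations differ. *)
- move=> [? ?]; move: o; rewrite n1 ?n2//=; lia.
- move=> [? ?]; move: o; rewrite n1 ?n2//=; lia.
- move=> [? ?]; rewrite IHv//.
  congr pair; lia.
Qed.

Lemma brow_le_den u : ((brow u).1 <= den u)%N /\ ((brow u).2 <= den u)%N.
Proof. by rewrite /den leq_addr leq_addl. Qed.

Lemma den_cons l u : den (l :: u) = (den u + (brow u).2)%N.
Proof. by rewrite /den /=; case: (brow u) => c d; case: l => /=; lia. Qed.

Lemma size_den u : (size u < den u)%N.
Proof.
by elim: u => //= l u IH; rewrite den_cons; have := brow2_gt0 u; lia.
Qed.

(* 81/50 exceeds the golden ratio, while (81/50)^10 < 2^7. *)
Definition growth : R := 81 / 50.

(** Fibonacci-type recursion: a new letter adds the second entry to [den], and both new entries are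
    among the old second entry and the old [den]. The induction closes because
    [1 + growth <= growth ^+ 2]. *)
Lemma brow_growth (k : R) u v : 0 <= k ->
  (brow u).1%:R <= k -> (brow u).2%:R <= k -> (den u)%:R <= k * growth ->
  [/\ (brow (v ++ u)).1%:R <= k * growth ^+ size v,
      (brow (v ++ u)).2%:R <= k * growth ^+ size v &
      (den (v ++ u))%:R <= k * growth ^+ (size v).+1].
Proof.
move=> k0 h1 h2 h3; elim: v => [|l v [IH1 IH2 IH3]].
  by rewrite /= expr0 expr1 mulr1.
have g0 : 0 <= k * growth ^+ size v.
  by rewrite mulr_ge0 ?exprn_ge0// /growth; lra.
rewrite cat_cons den_cons [size _]/= natrD.
have e : k * growth ^+ (size v).+2 = k * growth ^+ size v * (81 / 50) ^+ 2.
  by rewrite /growth -mulrA -exprD addn2.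
have e' : k * growth ^+ (size v).+1 = k * growth ^+ size v * (81 / 50).
  by rewrite /growth exprSr mulrA.
move: IH1 IH2 IH3 g0; rewrite e' e /den /=.
case: (brow (v ++ u)) => c d /=; rewrite natrD.
by case: l => /= *; split; rewrite ?natrD; lra.
Qed.

Lemma den_le_growth u : (den u)%:R <= growth ^+ (size u).+1.
Proof.
have [||||_ _] := @brow_growth 1 [::] u; rewrite ?cats0 ?mul1r ?expr1 //=.
by rewrite /growth /den /=; lra.
Qed.

Lemma lin_le u x : 0 <= x <= 1 -> lin u x <= (den u)%:R.
Proof.
move=> /andP[x0 x1]; rewrite /lin /den natrD lerD2r.
by rewrite ler_piMr.
Qed.

Lemma lin_ge u x : x <= 1 -> (den u)%:R * x <= lin u x.
Proof.
move=> x1; rewrite /lin /den natrD mulrDl lerD2l.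
by rewrite ler_piMr.
Qed.

Lemma mobB_norm u x y : 0 <= x <= 1 -> 0 <= y <= 1 ->
  `|mob u x - mob u y| = `|x - y| / (lin u x * lin u y).
Proof.
move=> /andP[x0 _] /andP[y0 _].
rewrite mobB// normrM normfV normrM normr_sign mul1r.
by congr (_ / _); rewrite gtr0_norm// mulr_gt0 ?lin_gt0.
Qed.

Lemma mob10_norm u : `|mob u 1 - mob u 0| = ((den u)%:R * (brow u).2%:R)^-1.
Proof.
rewrite mobB_norm ?lexx ?ler01// subr0 normr1 mul1r /lin mulr1 mulr0 add0r.
by rewrite -natrD.
Qed.

Lemma mob10_le u : `|mob u 1 - mob u 0| <= (size u).+1%:R^-1.
Proof.
rewrite mob10_norm lef_pV2 ?posrE ?mulr_gt0 ?ltr0n//; last 2 first.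
- exact: leq_trans (size_den u).
- exact: brow2_gt0.
rewrite -natrM ler_nat (leq_trans (size_den u))// leq_pmulr//.
exact: brow2_gt0.
Qed.

End words.

(** * Averages over words and stopping words *)

Section averages.
Context {R : realType}.
Implicit Types (x y c : R) (u v : seq bool) (f g : R -> R).

(* [avg n f] is the integral of [f] against the uniform measure on the points
   [mob u 0] with [size u = n]. *)
Fixpoint avg n f : R :=
  if n is n'.+1 then
    (avg n' (f \o branch false) + avg n' (f \o branch true)) / 2
  else f 0.

(** By [minkowski_mob10] below, this is the mass of the cylinder of [u]. *)
Definition weight u : R := (2 ^+ size u)^-1.

Lemma weight_gt0 u : 0 < weight u.
Proof. by rewrite invr_gt0 exprn_gt0. Qed.

Lemma weight_cons l u : weight (l :: u) = weight u / 2.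
Proof. by rewrite /weight /= exprS invfM mulrC. Qed.

Lemma le_avg n f g : (forall x, 0 <= x <= 1 -> f x <= g x) -> avg n f <= avg n g.
Proof.
elim: n f g => [|n IH] f g fg /=; first by rewrite fg// lexx ler01.
by rewrite ler_pM2r ?invr_gt0// lerD// IH// => x x01; apply: fg; exact: branch_itv.
Qed.

Lemma eq_avg n f g : (forall x, 0 <= x <= 1 -> f x = g x) -> avg n f = avg n g.
Proof. by move=> fg; apply/eqP; rewrite eq_le !le_avg// => x /fg ->. Qed.

Lemma avg_cst n c : avg n (fun=> c) = c.
Proof. by elim: n => //= n; rewrite /comp => ->; field. Qed.

Lemma avgD n f g : avg n (fun x => f x + g x) = avg n f + avg n g.
Proof. by elim: n f g => //= n IH f g; rewrite /comp !IH; field. Qed.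

Lemma avgZ n c f : avg n (fun x => c * f x) = c * avg n f.
Proof. by elim: n f => //= n IH f; rewrite /comp !IH; field. Qed.

Lemma avg_sum n (I : Type) (s : seq I) (F : I -> R -> R) :
  avg n (fun x => \sum_(i <- s) F i x) = \sum_(i <- s) avg n (F i).
Proof.
elim: s => [|i s IH].
  rewrite big_nil -[RHS](avg_cst n 0); apply: eq_avg => x _.
  by rewrite big_nil.
by rewrite big_cons -IH -avgD; apply: eq_avg => x _; rewrite big_cons.
Qed.

Lemma sqr_avg_le n f : avg n f ^+ 2 <= avg n (fun x => f x ^+ 2).
Proof.
elim: n f => //= n IH f; have := IH (f \o branch false).
have := IH (f \o branch true); rewrite /comp; set a := avg _ _; set b := avg _ _.
set a' := avg _ _; set b' := avg _ _ => h1 h2.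
have : 0 <= (a' - a) ^+ 2 by exact: sqr_ge0.
by nra.
Qed.

Definition lipschitz01 c f := forall x y, 0 <= x <= 1 -> 0 <= y <= 1 ->
  `|f x - f y| <= c * `|x - y|.

(** The extra letter is applied innermost, so it moves each point only inside a cylinder of depth
    [n + size u], whose length [mob10_le] bounds. *)
Lemma avgS_near c n f u : 0 <= c -> lipschitz01 c f ->
  `|avg n (f \o mob u) - avg n.+1 (f \o mob u)| <= c / (n + size u).+1%:R.
Proof.
move=> c0 fc; elim: n u => [|n IH] u.
  have b0 : 0 <= (0 : R) <= 1 by rewrite lexx ler01.
  have b1 : 0 <= (1 : R) <= 1 by rewrite lexx ler01.
  (* The branches send 0 to 0 and to 1, so the value at one end of the cylinder is compared with the
     mean over both ends. *)
  rewrite /= mul0r addr0 invr1 add0n.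
  have := fc (mob u 0) (mob u 1) (mob_itv u b0) (mob_itv u b1).
  have := @mob10_le R u; rewrite distrC => /(ler_wpM2l c0).
  set a := f _; set b := f _ => /[swap] /le_trans/[apply].
  have -> : a - (a + b) / 2 = (a - b) / 2 by field.
  rewrite normrM [`|2^-1|]ger0_norm ?invr_ge0//; have := normr_ge0 (a - b).
  move: `|a - b| (c / _) => p q; lra.
have := IH (false :: u); have := IH (true :: u); rewrite [size _]/= !addnS.
set e := c / _.
have -> : avg n.+1 (f \o mob u) =
  (avg n (f \o mob (false :: u)) + avg n (f \o mob (true :: u))) / 2 by [].
have -> : avg n.+2 (f \o mob u) =
  (avg n.+1 (f \o mob (false :: u)) + avg n.+1 (f \o mob (true :: u))) / 2 by [].
rewrite ?addSn -?/e !ler_norml; lra.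
Qed.

(** [k] is fuel. Every letter raises [den] by at least 1, so [k = Q] lets each branch of the
    recursion reach the threshold [Q]. *)
Fixpoint stop (Q k : nat) u : seq (seq bool) :=
  if (Q <= den u)%N then [:: u] else
  if k is k'.+1 then stop Q k' (false :: u) ++ stop Q k' (true :: u)
  else [:: u].

(** The uniform measures on points of fixed depth are only approximately self-similar: stopping
    words have different lengths. Each of the at most [k] splittings trades depth [n.+1] for depth
    [n], at the cost given by [avgS_near]. *)
Lemma avg_stop c n Q k f u : 0 <= c -> lipschitz01 c f ->
  `|weight u * avg n (f \o mob u) -
    \sum_(v <- stop Q k u) weight v * avg n (f \o mob v)|
  <= weight u * (k%:R * (c / n.+1%:R)).
Proof.
move=> c0 fc; have e0 : 0 <= c / n.+1%:R by rewrite divr_ge0.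
elim: k u => [|k IH] u; have w0 := weight_gt0 u.
  rewrite mul0r mulr0 /=; case: ifP => _.
    by rewrite big_seq1 subrr normr0.
  by rewrite big_seq1 subrr normr0.
rewrite /=; case: ifP => _.
  by rewrite big_seq1 subrr normr0 !mulr_ge0// ltW.
rewrite big_cat/=.
have := IH (false :: u); have := IH (true :: u); have := @avgS_near c n f u c0 fc.
have -> : avg n.+1 (f \o mob u) =
  (avg n (f \o mob (false :: u)) + avg n (f \o mob (true :: u))) / 2 by [].
have : c / (n + size u).+1%:R <= c / n.+1%:R.
  by rewrite ler_wpM2l// lef_pV2 ?posrE ?ltr0n// ler_nat ltnS leq_addr.
rewrite -natr1; move: e0; set e := c / n.+1%:R; set e' := c / _.
rewrite !weight_cons.
move: (avg n _) => a; set b := avg n _; set d := avg n _.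
move: (\sum_(v <- _) _) => s1; move: (\sum_(v <- _) _) => s2.
move=> e0 ee /le_trans /(_ ee); rewrite !ler_norml => /andP[h1 h2].
by move=> /andP[h3 h4] /andP[h5 h6]; apply/andP; split; nra.
Qed.

Lemma suffix_stop Q k u v : v \in stop Q k u -> suffix u v.
Proof.
elim: k u => [|k IH] u /=; case: ifP => _.
- by rewrite inE => /eqP ->; exact: suffix_refl.
- by rewrite inE => /eqP ->; exact: suffix_refl.
- by rewrite inE => /eqP ->; exact: suffix_refl.
rewrite mem_cat => /orP[] /IH /suffixP[s ->]; rewrite -cat_rcons; exact: suffix_suffix.
Qed.

(** A word occurring in both halves would have two suffixes that disagree in the letter just before
    [u]; reversing turns them into prefixes, which can be compared. *)
Lemma stop_uniq Q k u : uniq (stop Q k u).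
Proof.
elim: k u => [|k IH] u /=; case: ifP => _ //.
rewrite cat_uniq !IH andbT /=; apply/hasPn => v /suffix_stop /suffixP[s vs].
apply/negP => /suffix_stop /suffixP[s' vs'].
have : rcons s true ++ u = rcons s' false ++ u.
  by rewrite !cat_rcons -vs -vs'.
move=> /(congr1 rev); rewrite !rev_cat !rev_rcons => /eqP.
by rewrite eqseq_cat// => /andP[_ /eqP[]].
Qed.

Lemma sum_weight_stop Q k u : \sum_(v <- stop Q k u) weight v = weight u.
Proof.
elim: k u => [|k IH] u /=; case: ifP => _; rewrite ?big_seq1//.
by rewrite big_cat/= !IH !weight_cons; field.
Qed.

Lemma stop_ge Q k u v : (Q <= den u + k)%N -> v \in stop Q k u -> (Q <= den v)%N.
Proof.
elim: k u => [|k IH] u /=.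
  by rewrite addn0 => h; rewrite h inE => /eqP ->.
case: ifP => [h _|_ h]; first by rewrite inE => /eqP ->.
rewrite mem_cat => /orP[] /IH; apply; rewrite den_cons; have := brow2_gt0 u; lia.
Qed.

(** A letter adds [(brow u).2 <= den u], so the first passage over [Q] overshoots by at most a
    factor 2. *)
Lemma stop_le Q k u v : (den u <= 2 * Q)%N -> v \in stop Q k u ->
  (den v <= 2 * Q)%N.
Proof.
elim: k u => [|k IH] u h /=; case: ifP => hQ.
- by rewrite inE => /eqP ->.
- by rewrite inE => /eqP ->.
- by rewrite inE => /eqP ->.
have [_ h'] := brow_le_den u.
rewrite mem_cat => /orP[] /IH; apply; rewrite den_cons; lia.
Qed.

End averages.

(** * Calculus *)

Section calculus.
Local Open Scope classical_set_scope.
Local Open Scope ring_scope.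
Context {R : realType}.
Implicit Types (x y a b c : R) (f g : R -> R).

Lemma is_derive_add f g x a b : is_derive x 1 f a -> is_derive x 1 g b ->
  is_derive x 1 (fun y => f y + g y) (a + b).
Proof. by move=> ? ?; exact: is_deriveD. Qed.

Lemma is_derive_sub f g x a b : is_derive x 1 f a -> is_derive x 1 g b ->
  is_derive x 1 (fun y => f y - g y) (a - b).
Proof. by move=> ? ?; exact: is_deriveB. Qed.

Lemma is_derive_mul f g x a b : is_derive x 1 f a -> is_derive x 1 g b ->
  is_derive x 1 (fun y => f y * g y) (a * g x + f x * b).
Proof.
move=> fa gb; have := is_deriveM fa gb.
by rewrite addrC /GRing.scale/= [g x * a]mulrC.
Qed.

Lemma is_derive_inv f x a : f x != 0 -> is_derive x 1 f a ->
  is_derive x 1 (fun y => (f y)^-1) (- a / f x ^+ 2).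
Proof.
move=> f0 fa; have := is_deriveV f0 fa.
by rewrite /GRing.scale/= !mulNr [_ * a]mulrC.
Qed.

Lemma is_derive_const c x : is_derive x 1 (fun=> c) 0.
Proof. exact: is_derive_cst. Qed.

Lemma is_derive_var x : is_derive x 1 (fun y : R => y) 1.
Proof. exact: is_derive_id. Qed.

Lemma is_derive_cosf f x a : is_derive x 1 f a ->
  is_derive x 1 (fun y => cos (f y)) (- sin (f x) * a).
Proof.
by move=> fa; exact: (@is_derive1_comp _ cos f x (- sin (f x)) a).
Qed.

Lemma is_derive_sinf f x a : is_derive x 1 f a ->
  is_derive x 1 (fun y => sin (f y)) (cos (f x) * a).
Proof.
by move=> fa; exact: (@is_derive1_comp _ sin f x (cos (f x)) a).
Qed.

Lemma is_derive_atanf f x a : is_derive x 1 f a ->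
  is_derive x 1 (fun y => atan (f y)) ((1 + f x ^+ 2)^-1 * a).
Proof.
by move=> fa; exact: (@is_derive1_comp _ atan f x ((1 + f x ^+ 2)^-1) a).
Qed.

Lemma is_derive_bigsum (I : Type) (s : seq I) (F : I -> R -> R) (dF : I -> R) x :
  (forall i, is_derive x 1 (F i) (dF i)) ->
  is_derive x 1 (fun y => \sum_(i <- s) F i y) (\sum_(i <- s) dF i).
Proof.
move=> h; elim: s => [|i s IH].
  rewrite big_nil (_ : (fun _ => _) = fun=> 0); first exact: is_derive_const.
  by apply/funext => y; rewrite big_nil.
rewrite big_cons (_ : (fun _ => _) = fun y => F i y + \sum_(j <- s) F j y).
  exact: is_derive_add.
by apply/funext => y; rewrite big_cons.
Qed.

Lemma derive_ge0_le f df a b :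
  (forall x, a <= x <= b -> is_derive x 1 f (df x)) ->
  (forall x, a <= x <= b -> 0 <= df x) ->
  forall x y, a <= x -> x <= y -> y <= b -> f x <= f y.
Proof.
move=> fd df0 x y ax xy yb; rewrite -subr_ge0.
have fd' z : z \in `]x, y[ -> is_derive z 1 f (df z).
  by rewrite in_itv/= => /andP[? ?]; apply: fd; lra.
have fc : {within `[x, y]%classic, continuous f}.
  apply: derivable_within_continuous => z; rewrite in_itv/= => /andP[? ?].
  have zab : a <= z <= b by lra.
  by case: (fd z zab).
have [c + ->] := MVT_segment xy fd' fc.
rewrite in_itv/= => /andP[? ?]; rewrite mulr_ge0 ?subr_ge0 ?df0//; lra.
Qed.

(* Gallagher's inequality [sup G <= int (B G + |G'|)] on an interval of length
   at least [1/B], with the integral replaced by an antiderivative. *)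
Lemma gallagher (G dG Phi dPhi : R -> R) B p q : 0 < B -> B^-1 <= q - p ->
  (forall x, p <= x <= q -> is_derive x 1 G (dG x)) ->
  (forall x, p <= x <= q -> is_derive x 1 Phi (dPhi x)) ->
  (forall x, p <= x <= q -> 0 <= G x) ->
  (forall x, p <= x <= q -> B * G x + `|dG x| <= dPhi x) ->
  forall x, p <= x <= q -> G x <= Phi q - Phi p.
Proof.
move=> B0 Bpq hG hPhi G0 h x /andP[px xq].
have pq : p <= q by lra.
have Gc : {within `[p, q]%classic, continuous G}.
  apply: derivable_within_continuous => z; rewrite in_itv/= => zab.
  by case: (hG z zab).
have [y + ymin] := EVT_min pq Gc; rewrite in_itv/= => /andP[py yq].
have {}ymin z : p <= z <= q -> G y <= G z.
  by move=> zpq; apply: ymin; rewrite in_itv.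
(* With [G] replaced by its minimum [G y], the slope of [Phi] still dominates [B * G y + |dG|]. The
   sign [s] handles a rise of [G] to the right or to the left of [y]. *)
have mono s : s = 1 \/ s = -1 -> forall u v, p <= u -> u <= v -> v <= q ->
    Phi u - B * G y * u - s * G u <= Phi v - B * G y * v - s * G v.
  move=> s1; apply: (@derive_ge0_le (fun z => Phi z - B * G y * z - s * G z)
      (fun z => dPhi z - (0 * z + B * G y * 1) - (0 * G z + s * dG z))) => z zpq.
    apply: is_derive_sub; last first.
      exact: (is_derive_mul (is_derive_const _ _) (hG z zpq)).
    apply: is_derive_sub; first exact: hPhi.
    exact: (is_derive_mul (is_derive_const _ _) (is_derive_var _)).
  have := h z zpq; have : B * G y <= B * G z by rewrite ler_pM2l// ymin.
  have := ler_norm (dG z); have := ler_norm (- dG z); rewrite normrN.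
  by case: s1 => ->; lra.
(* The minimum is at most the mean, as the interval has length at least [1/B]; the variation of [G]
   between [y] and [x] accounts for the rest. *)
have BG : G y <= B * G y * (q - p).
  have Gy0 : 0 <= G y by rewrite G0// py.
  have : 1 <= B * (q - p) by rewrite -(mulfV (lt0r_neq0 B0)) ler_pM2l.
  by rewrite mulrAC; nra.
have m0 := mono 1 (or_introl erefl); have m1 := mono (-1) (or_intror erefl).
have [yx|/ltW xy] := leP y x.
  have := m0 y x py yx xq; have := m0 p y (lexx _) py yq.
  have := m1 p y (lexx _) py yq; have := m0 x q px xq (lexx _).
  have := m1 x q px xq (lexx _); lra.
have := m1 x y px xy yq; have := m0 p x (lexx _) px xq.
have := m1 p x (lexx _) px xq; have := m0 y q py yq (lexx _).
have := m1 y q py yq (lexx _); lra.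
Qed.

(** If [|k| >= D/2], the arctangent antiderivative works, with total increase at most [4 / (|k| r)]
    because pi < 4. Otherwise [|m| >= D], so the affine function stays at least [D/2] in absolute
    value on [0, 1] and the constant [4 / D^2] is a majorant. Here [k x + m] will be the difference
    of two denominators. *)
Lemma lorentz_antiderivative (k m r D : R) : 0 < r -> r <= D ->
  D <= `|k| \/ D <= `|m| ->
  exists F dF : R -> R,
    [/\ forall x, 0 <= x <= 1 -> is_derive x 1 F (dF x) /\
          ((k * x + m) ^+ 2 + r ^+ 2)^-1 <= dF x,
        forall x y, 0 <= x -> x <= y -> y <= 1 -> F y - F x <= 8 / (r * D) &
        forall x y, 0 <= x -> x <= y -> y <= 1 ->
          `|k| * (F y - F x) <= 4 / r].
Proof.
move=> r0 rD hD; have D0 : 0 < D by exact: lt_le_trans rD.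
have [kD|kD] := leP (D / 2) `|k|.
  have k0 : k != 0 by rewrite -normr_gt0; lra.
  have kr : k * r != 0 by rewrite mulf_neq0// lt0r_neq0.
  have nk0 : 0 < `|k| by rewrite normr_gt0.
  have ad x y : (atan ((k * y + m) * r^-1) - atan ((k * x + m) * r^-1)) <= 4 /\
      - 4 <= (atan ((k * y + m) * r^-1) - atan ((k * x + m) * r^-1)).
    have := atan_gtNpi2 ((k * y + m) * r^-1).
    have := atan_gtNpi2 ((k * x + m) * r^-1).
    have := atan_ltpi2 ((k * y + m) * r^-1).
    have := atan_ltpi2 ((k * x + m) * r^-1).
    have : (pi : R) / 2 < 2 by exact: pihalf_lt2.
    lra.
  have Fb x y : `|k| * ((k * r)^-1 * atan ((k * y + m) * r^-1) -
                  (k * r)^-1 * atan ((k * x + m) * r^-1)) <= 4 / r.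
    rewrite -mulrBr invfM; have [] := ad x y.
    set d := _ - _ => d1 d2.
    have -> : `|k| * (k^-1 * r^-1 * d) = (`|k| / k * d) / r by ring.
    rewrite ler_pM2r ?invr_gt0//.
    have [kp|kn|k00] := ltgtP 0 k; last by rewrite -k00 eqxx in k0.
    - by rewrite gtr0_norm// divff// mul1r.
    - by rewrite ltr0_norm// mulNr divff// mulN1r; lra.
  exists (fun x => (k * r)^-1 * atan ((k * x + m) * r^-1)).
  exists (fun x => ((k * x + m) ^+ 2 + r ^+ 2)^-1); split.
  - move=> x x01; split => //.
    have E0 : (k * x + m) ^+ 2 + r ^+ 2 != 0.
      by rewrite lt0r_neq0// ltr_wpDl ?sqr_ge0// exprn_gt0.
    have := is_derive_mul (is_derive_const (k * r)^-1 x)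
      (is_derive_atanf (is_derive_mul (is_derive_add (is_derive_mul
        (is_derive_const k x) (is_derive_var x)) (is_derive_const m x))
        (is_derive_const r^-1 x))).
    move=> /is_derive_eq; apply.
    field; rewrite E0 k0 lt0r_neq0//= addrC E0//.
  - move=> x y _ _ _; have := Fb x y; set F := _ - _ => FF.
    have h : D / 2 * F <= 4 / r.
      have [F0|F0] := leP 0 F; first by rewrite (le_trans _ FF)// ler_wpM2r.
      by apply: (@le_trans _ _ 0); [nra|rewrite divr_ge0// ltW].
    have -> : 8 / (r * D) = (4 / r) / (D / 2) by field; rewrite !lt0r_neq0.
    by rewrite ler_pdivlMr ?divr_gt0// mulrC.
  - by move=> x y _ _ _; exact: Fb.
have mD : D <= `|m| by case: hD; lra.
exists (fun x => 4 / D ^+ 2 * x), (fun x => 4 / D ^+ 2).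
have D4 : 4 / D ^+ 2 <= 4 / (r * D).
  by rewrite ler_wpM2l// lef_pV2 ?posrE ?mulr_gt0// expr2 ler_pM2r.
have D40 : 0 < 4 / D ^+ 2 by rewrite divr_gt0 ?exprn_gt0.
split.
- move=> x /andP[x0 x1]; split.
    have := is_derive_mul (is_derive_const (4 / D ^+ 2) x) (is_derive_var x).
    by rewrite mul0r add0r mulr1.
  have h : D / 2 <= `|k * x + m|.
    have := lerB_dist m (- (k * x)); rewrite opprK normrN normrM (ger0_norm x0).
    have : `|k| * x <= `|k| by rewrite ler_piMr.
    by rewrite [m + _]addrC; lra.
  have -> : 4 / D ^+ 2 = ((D / 2) ^+ 2)^-1 by field; rewrite lt0r_neq0.
  have d0 : 0 < (D / 2) ^+ 2 by rewrite exprn_gt0// divr_gt0.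
  have h2 : (D / 2) ^+ 2 <= (k * x + m) ^+ 2.
    by rewrite -[leRHS]real_normK ?num_real// ler_sqr ?nnegrE// ltW ?divr_gt0.
  have : 0 <= r ^+ 2 by exact: sqr_ge0.
  move: (r ^+ 2) (_ ^+ 2) (_ ^+ 2) d0 h2 => a b e b0 be a0.
  by rewrite lef_pV2 ?posrE//; lra.
- move=> x y x0 xy y1; rewrite -mulrBr (le_trans _ (_ : 4 / (r * D) <= _))//.
    by rewrite (le_trans _ D4)// ler_piMr//; [exact: ltW|lra].
  by rewrite ler_pM2r ?invr_gt0 ?mulr_gt0//; lra.
- move=> x y x0 xy y1; rewrite -mulrBr.
  have h1 : 4 / D ^+ 2 * (y - x) <= 4 / (r * D).
    by rewrite (le_trans _ D4)// ler_piMr//; [exact: ltW|lra].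
  have h0 : 0 <= 4 / D ^+ 2 * (y - x) by rewrite mulr_ge0 ?subr_ge0// ltW.
  apply: (@le_trans _ _ (D * (4 / (r * D)))); first by rewrite ler_pM//; lra.
  by rewrite le_eqVlt; apply/orP; left; apply/eqP; field; rewrite !lt0r_neq0.
Qed.

End calculus.

(** * The oscillatory integral of a pair of words *)

Section pair.
Local Open Scope classical_set_scope.
Local Open Scope ring_scope.
Context {R : realType}.

Lemma is_derive_affine (k m x : R) : is_derive x 1 (fun y => k * y + m) k.
Proof.
have := is_derive_add (is_derive_mul (is_derive_const k x) (is_derive_var x))
  (is_derive_const m x).
by rewrite mul0r add0r mulr1 addr0.
Qed.

(** AM-GM: [2 |U| r <= U^2 + r^2]. *)
Lemma lorentz_quotient_bound (U r : R) : 0 < r ->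
  `|U / (U * U + r * r)| <= (2 * r)^-1.
Proof.
move=> r0; have E0 : 0 < U * U + r * r.
  by rewrite ltr_wpDl ?mulr_gt0// -expr2 sqr_ge0.
rewrite normrM [`|_^-1|]gtr0_norm ?invr_gt0// ler_pdivrMr//.
rewrite -[leLHS]mul1r ler_pdivlMl ?mulr_gt0// mul1r.
have : 0 <= (`|U| - r) ^+ 2 by exact: sqr_ge0.
have : `|U| * `|U| = U * U by rewrite -expr2 real_normK ?num_real// expr2.
by nra.
Qed.

(** The left side is the derivative of [N U / (V E)]. Its bound has a constant part and a multiple
    of [|dU| / E], which [lorentz_antiderivative] integrates. *)
Lemma regularized_quotient_bound (N dN U dU V dV E r Q L Nb : R) :
  0 < r -> 0 < Q -> 1 <= L -> 2 * Q / L <= V -> 0 <= dV <= 4 * Q ->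
  0 <= N <= Nb -> `|dN| <= 4 * Nb ->
  E = U * U + r * r ->
  `|(dN * U + N * dU) * (V * E)^-1 +
    N * U * (- (dV * E + V * (dU * U + U * dU)) / (V * E) ^+ 2)|
  <= Nb * (2 * L ^+ 2 / (Q * r)) + Nb * (L / (2 * Q)) * (`|dU| * E^-1).
Proof.
move=> r0 Q0 L1 VQ /andP[dV0 dVQ] /andP[N0 NNb] dNb hE.
have L0 : 0 < L by lra.
have QL0 : 0 < 2 * Q / L by rewrite divr_gt0// mulr_gt0.
have V0 : 0 < V by lra.
have E0 : 0 < E by rewrite hE ltr_wpDl ?mulr_gt0// -expr2 sqr_ge0.
(* The terms with [dN] and [dV] keep the factor [U / E], at most [1 / (2 r)]; in the term with [dU]
   the factor [|r^2 - U^2| / E] is at most 1. *)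
have -> : (dN * U + N * dU) * (V * E)^-1 +
    N * U * (- (dV * E + V * (dU * U + U * dU)) / (V * E) ^+ 2) =
  dN * V^-1 * (U / E) - N * (dV * (V^-1 * V^-1)) * (U / E) +
  N * V^-1 * (dU * ((r * r - U * U) / E / E)).
  have En : U * U + r * r != 0 by rewrite -hE lt0r_neq0.
  by rewrite hE; field; rewrite En lt0r_neq0.
have UE : `|U / E| <= (2 * r)^-1 by rewrite hE lorentz_quotient_bound.
have VI : V^-1 <= L / (2 * Q).
  by rewrite -[leRHS]invrK lef_pV2 ?posrE ?invr_gt0 ?divr_gt0 ?mulr_gt0// invf_div.
have VI0 : 0 <= V^-1 by rewrite invr_ge0 ltW.
have rI : 0 <= (2 * r)^-1 by rewrite invr_ge0 mulr_ge0// ltW.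
have W : `|(r * r - U * U) / E / E| <= E^-1.
  rewrite normrM [`|E^-1|]gtr0_norm ?invr_gt0//.
  rewrite ler_piMl//; first by rewrite invr_ge0 ltW.
  rewrite normrM [`|E^-1|]gtr0_norm ?invr_gt0// ler_pdivrMr// mul1r.
  have : 0 <= U * U by rewrite -expr2 sqr_ge0.
  have : 0 <= r * r by rewrite -expr2 sqr_ge0.
  by rewrite ler_norml hE; lra.
have T1 : `|dN * V^-1 * (U / E)| <= 4 * Nb * (L / (2 * Q)) * (2 * r)^-1.
  rewrite normrM ler_pM// normrM [`|V^-1|]ger0_norm//; exact: ler_pM.
have T2 : `|N * (dV * (V^-1 * V^-1)) * (U / E)| <=
    Nb * (4 * Q * (L / (2 * Q) * (L / (2 * Q)))) * (2 * r)^-1.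
  rewrite normrM ler_pM// ger0_norm; last by rewrite !mulr_ge0.
  by rewrite ler_pM ?mulr_ge0// ler_pM ?mulr_ge0// ler_pM.
have T3 : `|N * V^-1 * (dU * ((r * r - U * U) / E / E))| <=
    Nb * (L / (2 * Q)) * (`|dU| * E^-1).
  rewrite normrM ger0_norm ?mulr_ge0// ler_pM ?mulr_ge0//; first exact: ler_pM.
  by rewrite normrM ler_wpM2l.
have e1 : 4 * Nb * (L / (2 * Q)) * (2 * r)^-1 = Nb * (L / (Q * r)).
  by field; rewrite !lt0r_neq0.
have e2 : Nb * (4 * Q * (L / (2 * Q) * (L / (2 * Q)))) * (2 * r)^-1 =
    Nb * (L * L / (Q * r)) / 2.
  by field; rewrite !lt0r_neq0.
have Nb0 : 0 <= Nb by exact: le_trans NNb.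
have h : Nb * (L / (Q * r)) <= Nb * (L * L / (Q * r)).
  rewrite ler_wpM2l // ler_pM2r ?invr_gt0 ?mulr_gt0//.
  by rewrite ler_peMr// ltW.
have h0 : 0 <= Nb * (L * L / (Q * r)).
  by rewrite mulr_ge0 // divr_ge0 ?mulr_ge0// ltW.
have -> : Nb * (2 * L ^+ 2 / (Q * r)) = 2 * (Nb * (L * L / (Q * r))) by ring.
rewrite (le_trans (ler_normD _ _))// lerD// (le_trans (ler_normB _ _))//.
by move: T1 T2; rewrite e1 e2; lra.
Qed.

(* Integration by parts of [a cos (t phi)], [phi' = sg U V / (X Y)^2], with the
   singular [1/U] replaced by [U / (U^2 + r^2)]. *)
Lemma pair_bound (Q L B t r D Nb A c d c' d' sg : R) (phi : R -> R) :
  let X x := c * x + d in let Y x := c' * x + d' in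
  let a x := 2 * B + t ^+ 2 / B / (X x ^+ 2 * Y x ^+ 2) in
  0 < Q -> 1 <= L -> 0 < B -> t != 0 -> 0 < r -> r <= D ->
  D <= `|c' - c| \/ D <= `|d' - d| ->
  0 <= c <= 2 * Q -> 0 <= c' <= 2 * Q -> `|sg| = 1 ->
  (forall x, L^-1 <= x <= 1 -> Q / L <= X x <= 2 * Q) ->
  (forall x, L^-1 <= x <= 1 -> Q / L <= Y x <= 2 * Q) ->
  (forall x, L^-1 <= x <= 1 ->
    is_derive x 1 phi (sg * (X x ^- 2 - Y x ^- 2))) ->
  (forall x, L^-1 <= x <= 1 -> a x <= A) ->
  32 * B * Q ^+ 4 + t ^+ 2 / B <= Nb ->
  exists Phi dPhi : R -> R,
    (forall x, L^-1 <= x <= 1 -> is_derive x 1 Phi (dPhi x)) /\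
    (forall x, L^-1 <= x <= 1 -> a x * cos (t * phi x) <= dPhi x) /\
    Phi 1 - Phi L^-1 <= 5 * (Nb / (`|t| * Q)) * L ^+ 2 / r + 8 * A * r / D.
Proof.
move=> X Y a Q0 L1 B0 t0 r0 rD hD /andP[c0 cQ] /andP[c'0 c'Q] sg1 hX hY hphi hA hN.
have L0 : 0 < L by lra.
have sg2 : sg * sg = 1 by rewrite -expr2 -real_normK ?num_real// sg1 expr1n.
have Li : L^-1 <= 1 by rewrite invf_le1.
have Li0 : 0 < L^-1 by rewrite invr_gt0.
have nt0 : 0 < `|t| by rewrite normr_gt0.
have tB0 : 0 <= t ^+ 2 / B by rewrite divr_ge0 ?sqr_ge0 ?ltW.
have Nb0 : 0 < Nb.
  by apply: lt_le_trans hN; rewrite ltr_wpDr// !mulr_gt0 ?exprn_gt0.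
have QL0 : 0 < Q / L by rewrite divr_gt0.
have [F [dF [hF F1 F2]]] := @lorentz_antiderivative R (c' - c) (d' - d) r D r0 rD hD.
(* Here [phi' = sg U V / (X Y)^2] and [a = Nf / (X Y)^2], so [a / phi' = sg Nf / (U V)]. The
   function [g] below is [Nf / (U V)] with [1/U] replaced by [U/E]. *)
pose U x := Y x - X x; pose V x := Y x + X x.
pose E x := U x * U x + r * r.
pose Nf x := 2 * B * ((X x * X x) * (Y x * Y x)) + t ^+ 2 / B.
pose dNf x := 2 * B * ((c * X x + X x * c) * (Y x * Y x) +
                       (X x * X x) * (c' * Y x + Y x * c')).
pose dg x := (dNf x * U x + Nf x * (c' - c)) * (V x * E x)^-1 +
  Nf x * U x * (- ((c' + c) * E x + V x * ((c' - c) * U x + U x * (c' - c))) /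
    (V x * E x) ^+ 2).
have A0 : 0 < A.
  have h1 : L^-1 <= (1 : R) <= 1 by apply/andP; split.
  apply: lt_le_trans (hA 1 h1); rewrite /a ltr_wpDr ?mulr_gt0//.
  by rewrite divr_ge0// mulr_ge0 ?sqr_ge0.
have E0 (x : R) : 0 < E x by rewrite /E ltr_wpDl ?mulr_gt0// -expr2 sqr_ge0.
have V0 (x : R) : L^-1 <= x <= 1 -> 0 < V x.
  by move=> x1; have := hX x x1; have := hY x x1; rewrite /V; lra.
have hVE x : L^-1 <= x <= 1 -> V x * E x != 0.
  by move=> x1; rewrite mulf_neq0// lt0r_neq0// V0.
have dX x := is_derive_affine c d x; have dY x := is_derive_affine c' d' x.
have dU x := is_derive_sub (dY x) (dX x).
have dV x := is_derive_add (dY x) (dX x).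
have dE (x : R) : is_derive x 1 E ((c' - c) * U x + U x * (c' - c)).
  have := is_derive_add (is_derive_mul (dU x) (dU x)) (is_derive_const (r * r) x).
  by rewrite addr0.
have dN (x : R) : is_derive x 1 Nf (dNf x).
  have := is_derive_add (is_derive_mul (is_derive_const (2 * B) x)
    (is_derive_mul (is_derive_mul (dX x) (dX x)) (is_derive_mul (dY x) (dY x))))
    (is_derive_const (t ^+ 2 / B) x).
  by rewrite mul0r add0r addr0.
pose g x := Nf x * U x * (V x * E x)^-1.
have dgE (x : R) : L^-1 <= x <= 1 -> is_derive x 1 g (dg x).
  move=> x1; exact: (is_derive_mul (is_derive_mul (dN x) (dU x))
    (@is_derive_inv _ (fun y => V y * E y) _ _ (hVE x x1)
      (is_derive_mul (dV x) (dE x)))).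
pose K1 := 2 * L ^+ 2 / (Q * r).
pose K2 := L / (2 * Q) * `|c' - c|.
have dgb x : L^-1 <= x <= 1 ->
    `|dg x| <= Nb * K1 + Nb * K2 * (E x)^-1 /\ `|g x| <= Nb * (L / (2 * Q)) / (2 * r).
  move=> x1; have /andP[X1 X2] := hX x x1; have /andP[Y1 Y2] := hY x x1.
  have X0 : 0 <= X x by lra.
  have Y0 : 0 <= Y x by lra.
  have QQ : 2 * Q / L = Q / L + Q / L by ring.
  have V1 : 2 * Q / L <= V x by rewrite QQ /V lerD.
  have XX : X x * X x <= (2 * Q) * (2 * Q) by rewrite ler_pM.
  have YY : Y x * Y x <= (2 * Q) * (2 * Q) by rewrite ler_pM.
  have cX : c * X x <= (2 * Q) * (2 * Q) by rewrite ler_pM.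
  have cY : c' * Y x <= (2 * Q) * (2 * Q) by rewrite ler_pM.
  have XXYY := ler_pM (mulr_ge0 X0 X0) (mulr_ge0 Y0 Y0) XX YY.
  have cXYY := ler_pM (mulr_ge0 c0 X0) (mulr_ge0 Y0 Y0) cX YY.
  have XXcY := ler_pM (mulr_ge0 X0 X0) (mulr_ge0 c'0 Y0) XX cY.
  have q4 : 2 * Q * (2 * Q) * (2 * Q * (2 * Q)) = 16 * Q ^+ 4 by ring.
  rewrite q4 in XXYY cXYY XXcY.
  have Nfb : 0 <= Nf x <= Nb.
    apply/andP; split.
      by rewrite /Nf addr_ge0// mulr_ge0 ?mulr_ge0// ltW.
    apply: le_trans hN; rewrite /Nf lerD2r.
    by move: (ler_wpM2l (ltW B0) XXYY); lra.
  have dNfE : dNf x = 4 * (B * (c * X x * (Y x * Y x))) +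
                      4 * (B * (X x * X x * (c' * Y x))).
    by rewrite /dNf; ring.
  have dNfb : `|dNf x| <= 4 * Nb.
    rewrite ger0_norm dNfE; last first.
      by rewrite addr_ge0// mulr_ge0// mulr_ge0 ?(ltW B0)// mulr_ge0 ?mulr_ge0.
    move: (ler_wpM2l (ltW B0) cXYY) (ler_wpM2l (ltW B0) XXcY) hN tB0.
    by lra.
  split.
    have cc : 0 <= c' + c <= 4 * Q by lra.
    have := regularized_quotient_bound (c' - c) r0 Q0 L1 V1 cc Nfb dNfb (erefl (E x)).
    by rewrite /dg /K1 /K2 !mulrA.
  have -> : g x = Nf x * (V x)^-1 * (U x / E x).
    by rewrite /g invfM; ring.
  have /andP[N0 NN] := Nfb.
  rewrite normrM ler_pM//; last exact: lorentz_quotient_bound.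
  have VI0 : 0 <= (V x)^-1 by rewrite invr_ge0 ltW ?V0.
  rewrite ger0_norm ?mulr_ge0// ler_pM//.
  by rewrite -[leRHS]invrK lef_pV2 ?posrE ?V0 ?invr_gt0 ?divr_gt0 ?mulr_gt0// invf_div.
(* The first term has derivative [a cos (t phi)], up to [dg sin (t phi) sg / t] and the
   regularization error [a (r^2 / E) cos (t phi)]. The linear term and the multiple of [F] dominate
   both errors. *)
pose Phi x := sg / t * (g x * sin (t * phi x)) +
  ((Nb / `|t| * K1) * x + (Nb / `|t| * K2 + A * r ^+ 2) * F x).
pose dPhi x := sg / t * (dg x * sin (t * phi x) +
      g x * (cos (t * phi x) * (t * (sg * (X x ^- 2 - Y x ^- 2))))) +
  ((Nb / `|t| * K1) + (Nb / `|t| * K2 + A * r ^+ 2) * dF x).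
exists Phi, dPhi; split; [|split].
- move=> x x1; have x01 : 0 <= x <= 1 by lra.
  have [hFx _] := hF x x01.
  have dphi := is_derive_mul (is_derive_const t x) (hphi x x1).
  have := is_derive_add (is_derive_mul (is_derive_const (sg / t) x)
    (is_derive_mul (dgE x x1) (is_derive_sinf dphi)))
    (is_derive_add (is_derive_mul (is_derive_const (Nb / `|t| * K1) x) (is_derive_var x))
     (is_derive_mul (is_derive_const (Nb / `|t| * K2 + A * r ^+ 2) x) hFx)).
  by rewrite /dPhi !mul0r !add0r mulr1.
- move=> x x1; have x01 : 0 <= x <= 1 by lra.
  have [_ hFx] := hF x x01; have [dgb1 _] := dgb x x1.
  have /andP[X1 _] := hX x x1; have /andP[Y1 _] := hY x x1.
  have Xn : X x != 0 by rewrite lt0r_neq0//; lra.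
  have Yn : Y x != 0 by rewrite lt0r_neq0//; lra.
  have Vn : V x != 0 by rewrite lt0r_neq0// V0.
  have En : E x != 0 by rewrite lt0r_neq0.
  have hE1 : (E x)^-1 <= dF x.
    by move: hFx; rewrite (_ : _ ^+ 2 + r ^+ 2 = E x)// /E /U /X /Y; ring.
  have EI0 : 0 <= (E x)^-1 by rewrite invr_ge0 ltW.
  have K20 : 0 <= K2 by rewrite /K2 mulr_ge0// divr_ge0 ?mulr_ge0 ?ltW.
  pose T1 := sg / t * (dg x * sin (t * phi x)).
  pose T2 := a x * (r ^+ 2 * (E x)^-1) * cos (t * phi x).
  have -> : dPhi x = T1 + (a x * cos (t * phi x) - T2) +
     ((Nb / `|t| * K1) + (Nb / `|t| * K2 + A * r ^+ 2) * dF x).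
    rewrite /dPhi /T1 /T2 -/T1; congr (_ + _); rewrite mulrDr; congr (_ + _).
    have -> : sg / t * (g x * (cos (t * phi x) * (t * (sg * (X x ^- 2 - Y x ^- 2))))) =
        sg * sg * (g x * (cos (t * phi x) * (X x ^- 2 - Y x ^- 2))).
      by field; rewrite Xn Yn t0.
    rewrite sg2 mul1r.
    have -> : g x * (cos (t * phi x) * (X x ^- 2 - Y x ^- 2)) =
        Nf x * (U x * (Y x - X x)) * (Y x + X x) / (V x * E x) *
        (X x ^- 2 * Y x ^- 2) * cos (t * phi x).
      by rewrite /g; field; rewrite Xn Yn Vn En.
    rewrite -/(U x) -/(V x).
    have -> : a x = Nf x * (X x ^- 2 * Y x ^- 2).
      by rewrite /a /Nf; field; rewrite Xn Yn lt0r_neq0.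
    have -> : U x * U x = E x - r ^+ 2 by rewrite /E; ring.
    by field; rewrite Xn Yn Vn En.
  have T1b : `|T1| <= Nb / `|t| * K1 + Nb / `|t| * K2 * (E x)^-1.
    rewrite /T1 normrM normrM sg1 mul1r normfV normrM.
    have -> : Nb / `|t| * K1 + Nb / `|t| * K2 * (E x)^-1 =
       `|t|^-1 * ((Nb * K1 + Nb * K2 * (E x)^-1) * 1) by ring.
    by rewrite ler_wpM2l ?invr_ge0// ler_pM// ler_norml sin_geN1 sin_le1.
  have a0 : 0 <= a x.
    by rewrite /a addr_ge0 ?(mulr_ge0 _ (ltW B0))// divr_ge0// mulr_ge0 ?sqr_ge0.
  have T2b : `|T2| <= A * r ^+ 2 * (E x)^-1.
    have r20 : 0 <= r ^+ 2 by exact: sqr_ge0.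
    have ar0 : 0 <= a x * (r ^+ 2 * (E x)^-1) by rewrite (mulr_ge0 a0)// mulr_ge0.
    rewrite /T2 normrM ger0_norm// -[leRHS]mulr1 ler_pM//; last first.
      by rewrite ler_norml cos_geN1 cos_le1.
    by rewrite mulrA ler_wpM2r// ler_wpM2r ?sqr_ge0// hA.
  have : (Nb / `|t| * K2 + A * r ^+ 2) * (E x)^-1 <=
         (Nb / `|t| * K2 + A * r ^+ 2) * dF x.
    rewrite ler_wpM2l// addr_ge0//; first by rewrite (mulr_ge0 _ K20)// divr_ge0// ltW.
    by rewrite mulr_ge0 ?sqr_ge0// ltW.
  move: T1b T2b; rewrite !ler_norml mulrDl => /andP[h1 _] /andP[_ h2]; lra.
- have h1 : L^-1 <= (1 : R) <= 1 by apply/andP; split.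
  have hL : L^-1 <= L^-1 <= 1 by apply/andP; split.
  have [_ g1] := dgb _ h1; have [_ gL] := dgb _ hL.
  have sb y : `|sg / t * (g y * sin (t * phi y))| <= `|t|^-1 * `|g y|.
    rewrite normrM normrM sg1 mul1r normfV ler_wpM2l ?invr_ge0//.
    by rewrite normrM ler_piMr// ler_norml sin_geN1 sin_le1.
  have := F1 L^-1 1 (ltW Li0) Li (lexx _); have := F2 L^-1 1 (ltW Li0) Li (lexx _).
  have := le_trans (sb 1) (ler_wpM2l (ltW (_ : 0 < `|t|^-1)) g1).
  have := le_trans (sb L^-1) (ler_wpM2l (ltW (_ : 0 < `|t|^-1)) gL).
  rewrite /Phi invr_gt0 !ler_norml.
  set s1 := sg / t * _; set s2 := sg / t * _; set F' := F 1; set F'' := F _.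
  move=> /(_ nt0) /andP[hs2 _] /(_ nt0) /andP[_ hs1] hc hd.
  (* In units of [P L^2 / r], the two boundary values contribute at most 1/4 each, the linear term 2
     and the [K2] term 2, which is below 5. The term with [A] gives [8 A r / D]. *)
  pose P := Nb / (`|t| * Q).
  have P0 : 0 < P by rewrite divr_gt0 ?mulr_gt0.
  have e1 : `|t|^-1 * (Nb * (L / (2 * Q)) / (2 * r)) = P * (L / r) / 4.
    by rewrite /P; field; rewrite !lt0r_neq0.
  have e2 : Nb / `|t| * K1 = P * (2 * (L ^+ 2 / r)).
    by rewrite /P /K1; field; rewrite !lt0r_neq0.
  have e3 : Nb / `|t| * K2 = P * (L / 2) * `|c' - c|.
    by rewrite /P /K2; field; rewrite !lt0r_neq0.
  have hL2 : L / r <= L ^+ 2 / r by rewrite ler_pM2r ?invr_gt0// expr2 ler_peMr// ltW.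
  have hLr : 0 <= L ^+ 2 / r by rewrite divr_ge0 ?sqr_ge0// ltW.
  have h3 : P * (L / 2) * `|c' - c| * (F' - F'') <= P * (L / 2) * (4 / r).
    by rewrite -mulrA ler_wpM2l// mulr_ge0 ?ltW// divr_gt0.
  have h4 : A * r ^+ 2 * (F' - F'') <= A * r ^+ 2 * (8 / (r * D)).
    by rewrite ler_wpM2l// mulr_ge0 ?sqr_ge0// ltW.
  have e4 : A * r ^+ 2 * (8 / (r * D)) = 8 * A * r / D.
    by field; rewrite !lt0r_neq0//; lra.
  have e5 : P * (L / 2) * (4 / r) = 2 * (P * (L / r)) by field; rewrite !lt0r_neq0.
  have h5 := ler_wpM2l (ltW P0) hL2.
  have h6 : P * (2 * (L ^+ 2 / r)) * (1 - L^-1) <= P * (2 * (L ^+ 2 / r)).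
    have p0 : 0 <= P * (2 * (L ^+ 2 / r)) by rewrite mulr_ge0 ?(ltW P0)// mulr_ge0.
    by rewrite ler_piMr//; lra.
  have -> : 5 * (Nb / (`|t| * Q)) * L ^+ 2 / r = 5 * (P * (L ^+ 2 / r)).
    by rewrite /P; ring.
  move: hs1 hs2; rewrite e1 e2 e3; rewrite e4 in h4; rewrite e5 in h3.
  have := mulr_ge0 (ltW P0) hLr; lra.
Qed.

End pair.

(** * Mean squares of families of words *)

Section mean_square.
Local Open Scope classical_set_scope.
Local Open Scope ring_scope.
Context {R : realType}.
Implicit Types (x : R) (u v w : seq bool).

Lemma is_derive_mob u x : 0 <= x ->
  is_derive x 1 (@mob R u) ((-1) ^+ orient u / lin u x ^+ 2).
Proof.
elim: u x => [|l u IH] x x0.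
  by rewrite /lin /= mul0r add0r expr0 expr1n invr1 mulr1; exact: is_derive_id.
have h : 1 + x != 0 by apply: lt0r_neq0; lra.
have d1 : is_derive x 1 (fun y => 1 + y) (1 : R).
  by have := is_derive_add (is_derive_const 1 x) (is_derive_var x); rewrite add0r.
have db : is_derive x 1 (@branch R l) ((-1) ^+ l / (1 + x) ^+ 2).
  have dV := is_derive_inv h d1; case: l.
    by rewrite expr1; exact: dV.
  have := is_derive_mul (is_derive_var x) dV.
  by move=> /is_derive_eq; apply; rewrite expr0; field.
have := @is_derive1_comp _ (mob u) (branch l) x _ _ (IH _ (branch_ge0 l x0)) db.
move=> /is_derive_eq; apply; rewrite lin_cons//= signr_addb.
have := lt0r_neq0 (lin_gt0 u (branch_ge0 l x0)).
by move: (lin u _) ((-1) ^+ l) ((-1) ^+ orient u) => a b c a0; field; rewrite h a0.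
Qed.

(* [b] bounds the integral of [f] over [[a, 1]], witnessed by an
   antiderivative of a majorant of [f]. *)
Definition majorant (a : R) (f : R -> R) (b : R) :=
  exists Phi dPhi : R -> R,
    (forall x, a <= x <= 1 -> is_derive x 1 Phi (dPhi x)) /\
    (forall x, a <= x <= 1 -> f x <= dPhi x) /\
    Phi 1 - Phi a <= b.

Lemma majorant_le a f g b b' : (forall x, a <= x <= 1 -> g x <= f x) -> b <= b' ->
  majorant a f b -> majorant a g b'.
Proof.
move=> gf bb [F [dF [h1 [h2 h3]]]]; exists F, dF; split => //; split.
  by move=> x x1; rewrite (le_trans (gf x x1))// h2.
exact: le_trans bb.
Qed.

Lemma majorant_sum (I : eqType) (s : seq I) a (p : I -> R) (f : I -> R -> R)
    (b : I -> R) : (forall i, i \in s -> 0 <= p i) ->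
  (forall i, i \in s -> majorant a (f i) (b i)) ->
  majorant a (fun x => \sum_(i <- s) p i * f i x) (\sum_(i <- s) p i * b i).
Proof.
elim: s => [|i s IH] p0 h.
  exists (fun=> 0), (fun=> 0); split; first by move=> x _; exact: is_derive_const.
  by rewrite big_nil subrr; split => // x _; rewrite big_nil.
have [||F [dF [h1 [h2 h3]]]] := IH.
- by move=> k ks; rewrite p0// inE ks orbT.
- by move=> k ks; apply: h; rewrite inE ks orbT.
have [G [dG [g1 [g2 g3]]]] := h i (mem_head _ _).
have pi0 := p0 i (mem_head _ _).
exists (fun x => p i * G x + F x), (fun x => p i * dG x + dF x); split.
  move=> x x1.
  have := is_derive_add (is_derive_mul (is_derive_const (p i) x) (g1 x x1)) (h1 x x1).
  by rewrite mul0r add0r.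
split; first by move=> x x1; rewrite big_cons lerD ?h2// ler_wpM2l ?g2.
by rewrite big_cons; have := ler_wpM2l pi0 g3; lra.
Qed.

Lemma majorant_cst a c : 0 <= a <= 1 -> 0 <= c -> majorant a (fun=> c) c.
Proof.
move=> /andP[a0 a1] c0; exists (fun x => c * x), (fun=> c); split; last split => //.
  move=> x _; have := is_derive_mul (is_derive_const c x) (is_derive_var x).
  by rewrite mul0r add0r mulr1.
by rewrite -mulrBr ler_piMr//; lra.
Qed.

Definition far (D : nat) u v := [|| (brow u).1 + D <= (brow v).1,
  (brow v).1 + D <= (brow u).1, (brow u).2 + D <= (brow v).2 |
  (brow v).2 + D <= (brow u).2]%N.

Lemma far_norm D u v : far D u v ->
  D%:R <= `|(brow v).1%:R - (brow u).1%:R : R| \/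
  D%:R <= `|(brow v).2%:R - (brow u).2%:R : R|.
Proof.
have h (a b : nat) : (a + D <= b)%N -> D%:R <= `|b%:R - a%:R : R|.
  move=> abD; rewrite -natrB; last by lia.
  by rewrite normr_nat ler_nat; lia.
case/or4P => /h dd; [left|left; rewrite distrC|right|right; rewrite distrC] => //.
Qed.

Lemma near_box D w v : ~~ far D w v ->
  [/\ (brow w).1 < (brow v).1 + D, (brow w).2 < (brow v).2 + D,
      (brow v).1 + D - (brow w).1 < 2 * D &
      (brow v).2 + D - (brow w).2 < 2 * D]%N.
Proof.
rewrite /far; case: (brow w) => a b; case: (brow v) => c d /=.
by rewrite !negb_or -!ltnNge => /and4P[? ? ? ?]; split; lia.
Qed.

(** Numerical factors are absorbed into [Th ^+ 2]: two thirds of [q^2] already exceed 1000. *)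
Lemma absorb_constants (c p q : R) : 0 <= c <= 1000 -> 0 <= p -> 100 <= q ->
  c * p + q ^+ 2 / 3 * p <= q ^+ 2 * p.
Proof.
move=> /andP[c0 c1] p0 q0; rewrite -mulrDl ler_wpM2r//.
have := ler_pM (ler0n _ 100) (ler0n _ 100) q0 q0; rewrite -expr2; lra.
Qed.

(** * The mean square of one family of equally oriented words *)

Section family.
Variables (z L Th t : R) (j : nat).
Hypotheses (zE : z = 2 ^+ j) (L1 : 1 <= L) (Th1 : 100 <= Th).
Hypotheses (t_ge : z ^+ 35 <= `|t|) (t_le : `|t| <= Th * z ^+ 35).
Variables (s : seq (seq bool)) (o : bool).
Hypothesis s_uniq : uniq s.
Hypothesis s_orient : forall w, w \in s -> orient w = o.
Hypothesis s_den : forall w, w \in s -> (2 ^ (7 * j) <= den w <= 2 * 2 ^ (7 * j))%N.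
Hypothesis s_weight : forall w, w \in s -> weight w <= 2 / z ^+ 10.
Hypothesis s_sum : \sum_(w <- s) weight w <= 1 :> R.

(** The reciprocal of the cylinder length guaranteed by [mob_length_ge]. *)
Let B : R := 3 * L ^+ 2 * z ^+ 21.
(** For [F] the sum of [weight w * e^(i t mob w x)], this is the coefficient of [cos (t (w - v))] in
    [2 B |F|^2 + |F'|^2 / B]. Equal orientations make the product of the two derivatives
    positive. *)
Let amp w v x := 2 * B + t ^+ 2 / B / (lin w x ^+ 2 * lin v x ^+ 2).

Let z1 : 1 <= z. Proof. by rewrite zE exprn_ege1// ler1n. Qed.
Let z0 : 0 < z. Proof. exact: lt_le_trans z1. Qed.
Let L0 : 0 < L. Proof. exact: lt_le_trans L1. Qed.
Let z00 : 0 <= z. Proof. exact: ltW. Qed.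
Let L00 : 0 <= L. Proof. exact: ltW. Qed.
Let Th0 : 0 <= Th. Proof. exact: le_trans Th1. Qed.
Let B0 : 0 < B. Proof. by rewrite !mulr_gt0 ?exprn_gt0. Qed.
Let t2_le : t ^+ 2 / B <= Th ^+ 2 * z ^+ 49 / (3 * L ^+ 2).
Proof.
have h : t ^+ 2 <= Th ^+ 2 * z ^+ 70.
  rewrite -[leLHS]real_normK ?num_real//.
  have -> : Th ^+ 2 * z ^+ 70 = (Th * z ^+ 35) ^+ 2 by ring.
  by rewrite ler_sqr ?nnegrE// (le_trans _ t_le).
rewrite ler_pdivrMr// (le_trans h)// /B.
by rewrite le_eqVlt; apply/orP; left; apply/eqP; field; rewrite lt0r_neq0.
Qed.

Let linb w x : w \in s -> L^-1 <= x <= 1 -> z ^+ 7 / L <= lin w x <= 2 * z ^+ 7.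
Proof.
move=> ws /andP[x0 x1]; have Li0 : 0 < L^-1 by rewrite invr_gt0.
have xp : 0 <= x by lra.
have z7 : z ^+ 7 = (2 ^ (7 * j))%:R by rewrite zE natrX -exprM mulnC.
have /andP[d1 d2] := s_den ws.
rewrite z7; apply/andP; split.
  apply: le_trans (lin_ge w x1); apply: ler_pM => //; first exact: ltW.
  by rewrite ler_nat.
by rewrite (le_trans (lin_le w _)) ?xp ?x1// -natrM ler_nat.
Qed.

(** Denominators are at least [z^7 / L] on [1/L, 1], so the derivative part of [amp] is of order
    [L^2 z^21], like [B] itself. *)
Let amp_le w v x : w \in s -> v \in s -> L^-1 <= x <= 1 ->
  amp w v x <= Th ^+ 2 * L ^+ 2 * z ^+ 21.
Proof.
move=> ws vs x1; have /andP[w1 _] := linb ws x1; have /andP[v1 _] := linb vs x1.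
have zL0 : 0 < z ^+ 7 / L by rewrite divr_gt0 ?exprn_gt0.
have sq y : z ^+ 7 / L <= y -> (z ^+ 7 / L) ^+ 2 <= y ^+ 2.
  by move=> h; rewrite ler_sqr// nnegrE; [exact: ltW|lra].
have h : (lin w x ^+ 2 * lin v x ^+ 2)^-1 <= L ^+ 4 / z ^+ 28.
  have -> : L ^+ 4 / z ^+ 28 = ((z ^+ 7 / L) ^+ 2 * (z ^+ 7 / L) ^+ 2)^-1.
    by field; rewrite !lt0r_neq0.
  have lw0 : 0 < lin w x by lra.
  have lv0 : 0 < lin v x by lra.
  have p1 : 0 < (z ^+ 7 / L) ^+ 2 * (z ^+ 7 / L) ^+ 2 by rewrite mulr_gt0// exprn_gt0.
  have p2 : 0 < lin w x ^+ 2 * lin v x ^+ 2 by rewrite mulr_gt0// exprn_gt0.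
  rewrite lef_pV2 ?posrE//; apply: ler_pM (sq _ w1) (sq _ v1); exact: sqr_ge0.
have tB0 : 0 <= t ^+ 2 / B by rewrite divr_ge0 ?sqr_ge0 ?ltW.
have i0 : 0 <= (lin w x ^+ 2 * lin v x ^+ 2)^-1.
  by rewrite invr_ge0; apply: mulr_ge0; exact: sqr_ge0.
have := ler_pM tB0 i0 t2_le h.
have -> : Th ^+ 2 * z ^+ 49 / (3 * L ^+ 2) * (L ^+ 4 / z ^+ 28) =
   Th ^+ 2 / 3 * (L ^+ 2 * z ^+ 21) by field; rewrite !lt0r_neq0.
rewrite /amp => h2; have h3 : 0 <= L ^+ 2 * z ^+ 21 by rewrite !mulr_ge0 ?exprn_ge0.
have -> : 2 * B = 6 * (L ^+ 2 * z ^+ 21) by rewrite /B; ring.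
apply: le_trans (lerD (lexx _) h2) _.
by rewrite -[leRHS]mulrA; apply: absorb_constants => //; rewrite ler0n ler_nat.
Qed.

(** This is [pair_bound] with [Q = z^7] and [Nb = Th^2 L^2 z^49]; since [|t| >= z^35], the quotient
    [Nb / (|t| Q)] is at most [Th^2 L^2 z^7]. The parameter [r] stays free because its best value
    depends on [D]. *)
Let pair w v (r : R) (D : nat) : w \in s -> v \in s -> 0 < r -> r <= D%:R ->
  far D w v ->
  majorant L^-1 (fun x => amp w v x * cos (t * (mob w x - mob v x)))
    (5 * Th ^+ 2 * L ^+ 4 * z ^+ 7 / r + 8 * Th ^+ 2 * L ^+ 2 * z ^+ 21 * r / D%:R).
Proof.
move=> ws vs r0 rD /far_norm hD.
have Li0 : 0 < L^-1 by rewrite invr_gt0.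
have z35 : 0 < z ^+ 35 by rewrite exprn_gt0.
have t0 : t != 0 by rewrite -normr_gt0 (lt_le_trans z35).
have rowb u : u \in s -> 0 <= ((brow u).1%:R : R) <= 2 * z ^+ 7.
  move=> us; rewrite ler0n /=; have /andP[_ h] := s_den us.
  have -> : 2 * z ^+ 7 = (2 * 2 ^ (7 * j))%:R.
    by rewrite zE natrM natrX -exprM [(_ * 7)%N]mulnC.
  by rewrite ler_nat (leq_trans _ h)//; case: (brow_le_den u).
have dphi x : L^-1 <= x <= 1 -> is_derive x 1 (fun y => mob w y - mob v y)
    ((-1) ^+ o * (lin w x ^- 2 - lin v x ^- 2)).
  move=> /andP[x0 _]; have x00 : 0 <= x by lra.
  have := is_derive_sub (is_derive_mob w x00) (is_derive_mob v x00).
  by move=> /is_derive_eq; apply; rewrite !s_orient// -mulrBr.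
have hN : 32 * B * (z ^+ 7) ^+ 4 + t ^+ 2 / B <= Th ^+ 2 * L ^+ 2 * z ^+ 49.
  have L2 : 1 <= L ^+ 2 by rewrite exprn_ege1.
  have h1 : Th ^+ 2 * z ^+ 49 / (3 * L ^+ 2) <= Th ^+ 2 / 3 * (L ^+ 2 * z ^+ 49).
    have -> : Th ^+ 2 * z ^+ 49 / (3 * L ^+ 2) = (Th ^+ 2 / 3 * z ^+ 49) / L ^+ 2.
      by field; rewrite lt0r_neq0.
    have -> : Th ^+ 2 / 3 * (L ^+ 2 * z ^+ 49) = Th ^+ 2 / 3 * z ^+ 49 * L ^+ 2 by ring.
    rewrite ler_wpM2l//; first by rewrite !mulr_ge0 ?exprn_ge0.
    by rewrite (le_trans _ L2)// invf_le1// exprn_gt0.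
  have -> : 32 * B * (z ^+ 7) ^+ 4 = 96 * (L ^+ 2 * z ^+ 49) by rewrite /B; ring.
  have h2 : 0 <= L ^+ 2 * z ^+ 49 by rewrite !mulr_ge0 ?exprn_ge0.
  apply: le_trans (lerD (lexx _) (le_trans t2_le h1)) _.
  by rewrite -[leRHS]mulrA; apply: absorb_constants => //; rewrite ler0n ler_nat.
have [Phi [dPhi [P1 [P2 P3]]]] := @pair_bound R (z ^+ 7) L B t r D%:R
  (Th ^+ 2 * L ^+ 2 * z ^+ 49) (Th ^+ 2 * L ^+ 2 * z ^+ 21)
  (brow w).1%:R (brow w).2%:R (brow v).1%:R (brow v).2%:R ((-1) ^+ o)
  (fun y => mob w y - mob v y) (exprn_gt0 _ z0) L1 B0 t0 r0 rD hD (rowb w ws) (rowb v vs)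
  (normr_sign _ _) (fun x => linb ws) (fun x => linb vs) dphi
  (fun x => amp_le ws vs) hN.
exists Phi, dPhi; split => //; split => //; apply: (le_trans P3).
have -> : 8 * (Th ^+ 2 * L ^+ 2 * z ^+ 21) * r / D%:R =
  8 * Th ^+ 2 * L ^+ 2 * z ^+ 21 * r / D%:R by ring.
rewrite lerD2r.
have K0 : 0 <= 5 * (Th ^+ 2 * L ^+ 2) * L ^+ 2 / r.
  by rewrite divr_ge0 ?(ltW r0)// !mulr_ge0 ?exprn_ge0.
have -> : 5 * (Th ^+ 2 * L ^+ 2 * z ^+ 49 / (`|t| * z ^+ 7)) * L ^+ 2 / r =
  5 * (Th ^+ 2 * L ^+ 2) * L ^+ 2 / r * (z ^+ 42 / `|t|).
  by field; rewrite !lt0r_neq0// normr_gt0.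
have -> : 5 * Th ^+ 2 * L ^+ 4 * z ^+ 7 / r =
  5 * (Th ^+ 2 * L ^+ 2) * L ^+ 2 / r * z ^+ 7 by ring.
rewrite ler_wpM2l// ler_pdivrMr ?normr_gt0//.
have -> : z ^+ 42 = z ^+ 7 * z ^+ 35 by ring.
by rewrite ler_wpM2l// ltW// exprn_gt0.
Qed.

Let diag w v : w \in s -> v \in s ->
  majorant L^-1 (fun x => amp w v x * cos (t * (mob w x - mob v x)))
    (Th ^+ 2 * L ^+ 2 * z ^+ 21).
Proof.
move=> ws vs; have A0 : 0 <= Th ^+ 2 * L ^+ 2 * z ^+ 21.
  by rewrite !mulr_ge0 ?exprn_ge0.
apply: (@majorant_le _ (fun=> Th ^+ 2 * L ^+ 2 * z ^+ 21)); last first.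
- by apply: majorant_cst; rewrite // invr_ge0 ltW//= invf_le1.
- exact: lexx.
move=> x x1; have am := amp_le ws vs x1.
have a0 : 0 <= amp w v x.
  rewrite /amp addr_ge0 ?(mulr_ge0 _ (ltW B0))//; apply: divr_ge0.
    by apply: divr_ge0; [exact: sqr_ge0|exact: ltW].
  by apply: mulr_ge0; exact: sqr_ge0.
rewrite (le_trans _ am)// -[leRHS]mulr1 ler_wpM2l// cos_le1.
Qed.

Let bnd : R := Th ^+ 2 * L ^+ 4 * z ^+ 12.

(** In a family of one orientation the row determines the word by [orient_brow_inj], and the rows
    not far from that of [w] lie in a box of side less than [2 * D]. *)
Let near_count w D : (size [seq v <- s | ~~ far D w v] <= (2 * D) ^ 2)%N.
Proof.
(* The shift by [D] keeps the natural subtraction from truncating. *)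
pose h v := (((brow v).1 + D - (brow w).1)%N, ((brow v).2 + D - (brow w).2)%N).
have subI (a b c k : nat) : (c < a + k -> c < b + k -> a + k - c = b + k - c -> a = b)%N.
  by clear; lia.
have hinj : {in [seq v <- s | ~~ far D w v] &, injective h}.
  move=> u v; rewrite !mem_filter => /andP[fu us] /andP[fv vs] [h1 h2].
  have [u1 u2 _ _] := near_box fu; have [v1 v2 _ _] := near_box fv.
  apply: orient_brow_inj; first by rewrite !s_orient.
  have := subI _ _ _ _ u1 v1 h1; have := subI _ _ _ _ u2 v2 h2.
  by case: (brow u) => a b; case: (brow v) => a' b' /= -> ->.
rewrite -(size_map h [seq v <- s | ~~ far D w v]).
have -> : ((2 * D) ^ 2 = size [seq (a, b) | a <- iota 0 (2 * D), b <- iota 0 (2 * D)])%N.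
  by rewrite size_allpairs !size_iota mulnn.
apply: uniq_leq_size; first by rewrite map_inj_in_uniq// filter_uniq.
move=> p /mapP[v]; rewrite mem_filter => /andP[fv _] ->.
have [_ _ v1 v2] := near_box fv.
by apply/allpairsP; exists (h v); rewrite !mem_iota !add0n /= v1 v2.
Qed.

(** Three ranges of [v], with [D = z^4]. Far pairs cost [13 bnd] each and have total weight at most
    1. The at most [4 z^8] pairs within [D] but with distinct rows cost [13 bnd z^2] each, at weight
    at most [2 / z^10], in all [104 bnd]. Equal rows cost [8 bnd]. The sum is [125 bnd]. *)
Let majorant_row w : w \in s ->
  majorant L^-1 (fun x => \sum_(v <- s) weight v *
      (amp w v x * cos (t * (mob w x - mob v x)))) (125 * bnd).
Proof.
move=> ws.
pose D : nat := 2 ^ (4 * j).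
have zD : z ^+ 4 = D%:R by rewrite zE natrX -exprM mulnC.
pose b v : R := if far D w v then 13 * bnd else
  if far 1 w v then 13 * (bnd * z ^+ 2) else Th ^+ 2 * L ^+ 2 * z ^+ 21.
have L24 : L ^+ 2 <= L ^+ 4.
  by rewrite ler_weXn2l.
have T0 : 0 <= Th ^+ 2 by exact: sqr_ge0.
have zn n : 0 < z ^+ n by rewrite exprn_gt0.
have mb v : v \in s -> majorant L^-1
    (fun x => amp w v x * cos (t * (mob w x - mob v x))) (b v).
  move=> vs; rewrite /b; case: ifP => f1; last case: ifP => f2.
  (* The choice [r = z^-5] balances [z^7 / r] and [z^21 r / D] at [z^12]; for [D = 1] the balance is
     at [r = z^-7], with value [z^14]. *)
  - have r0 : 0 < (z ^+ 5)^-1 by rewrite invr_gt0.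
    have rD : (z ^+ 5)^-1 <= D%:R.
      rewrite -zD; apply: (@le_trans _ _ 1); rewrite ?exprn_ege1// invf_le1//.
      by rewrite exprn_ege1.
    apply: majorant_le (pair ws vs r0 rD f1) => //.
    have -> : 5 * Th ^+ 2 * L ^+ 4 * z ^+ 7 / (z ^+ 5)^-1 = 5 * bnd.
      by rewrite invrK /bnd; ring.
    have -> : 8 * Th ^+ 2 * L ^+ 2 * z ^+ 21 * (z ^+ 5)^-1 / D%:R =
        8 * (Th ^+ 2 * L ^+ 2 * z ^+ 12).
      by rewrite -zD; field; rewrite lt0r_neq0.
    have : Th ^+ 2 * L ^+ 2 * z ^+ 12 <= bnd.
      by rewrite /bnd ler_wpM2r ?(ltW (zn _))// ler_wpM2l.
    lra.
  - have r0 : 0 < (z ^+ 7)^-1 by rewrite invr_gt0.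
    have rD : (z ^+ 7)^-1 <= 1%:R by rewrite invf_le1// exprn_ege1.
    apply: majorant_le (pair ws vs r0 rD f2) => //.
    have -> : 5 * Th ^+ 2 * L ^+ 4 * z ^+ 7 / (z ^+ 7)^-1 = 5 * (bnd * z ^+ 2).
      by rewrite invrK /bnd; ring.
    have -> : 8 * Th ^+ 2 * L ^+ 2 * z ^+ 21 * (z ^+ 7)^-1 / 1%:R =
        8 * (Th ^+ 2 * L ^+ 2 * z ^+ 14).
      by field; rewrite lt0r_neq0.
    have : Th ^+ 2 * L ^+ 2 * z ^+ 14 <= bnd * z ^+ 2.
      have -> : bnd * z ^+ 2 = Th ^+ 2 * L ^+ 4 * z ^+ 14 by rewrite /bnd; ring.
      by rewrite ler_wpM2r ?(ltW (zn _))// ler_wpM2l.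
    lra.
  - exact: diag.
apply: majorant_le (majorant_sum _ mb) => //; last first.
  by move=> v _; rewrite ltW// weight_gt0.
pose P : R := 2 / z ^+ 10.
have P0 : 0 <= P by rewrite divr_ge0 ?exprn_ge0.
have bnd0 : 0 <= bnd by rewrite !mulr_ge0 ?exprn_ge0.
have A0 : 0 <= Th ^+ 2 * L ^+ 2 * z ^+ 21 by rewrite !mulr_ge0 ?exprn_ge0.
have N0 : 0 <= 13 * (bnd * z ^+ 2) by rewrite !mulr_ge0 ?exprn_ge0.
have sumc (Q : pred (seq bool)) (c : R) :
    \sum_(v <- s | Q v) c = (size [seq v <- s | Q v])%:R * c.
  by rewrite big_const_seq iter_addr_0 size_filter mulr_natl.
have h1 : \sum_(v <- s) weight v * b v <=
    \sum_(v <- s) weight v * (13 * bnd) +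
    (\sum_(v <- s | ~~ far D w v) P * (13 * (bnd * z ^+ 2)) +
     \sum_(v <- s | ~~ far 1 w v) P * (Th ^+ 2 * L ^+ 2 * z ^+ 21)).
  rewrite (big_mkcond (fun v => ~~ far D w v)) (big_mkcond (fun v => ~~ far 1 w v)).
  rewrite -!big_split/= big_seq [leRHS]big_seq; apply: ler_sum => v vs.
  have w0 : 0 <= weight v :> R by rewrite ltW// weight_gt0.
  have wP := s_weight vs; have m0 : 0 <= weight v * (13 * bnd) by rewrite !mulr_ge0.
  rewrite /b; case: (far D w v) => /=.
    by rewrite add0r lerDl; case: ifP => // _; rewrite mulr_ge0.
  case: (far 1 w v) => /=.
    by rewrite addr0 ler_wpDl// ler_wpM2r.
  by rewrite addrA ler_wpDl ?addr_ge0 ?(mulr_ge0 P0)// ler_wpM2r.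
rewrite (le_trans h1)// -mulr_suml !sumc.
have h2 := ler_wpM2r (_ : 0 <= 13 * bnd) s_sum.
have h3 := ler_wpM2r (mulr_ge0 P0 N0) (_ : _ <= ((2 * D) ^ 2)%:R).
have h4 := ler_wpM2r (mulr_ge0 P0 A0) (_ : _ <= ((2 * 1) ^ 2)%:R).
have e3 : ((2 * D) ^ 2)%:R * (P * (13 * (bnd * z ^+ 2))) = 104 * bnd.
  by rewrite natrX natrM -zD /P; field; rewrite lt0r_neq0.
have e4 : ((2 * 1) ^ 2)%:R * (P * (Th ^+ 2 * L ^+ 2 * z ^+ 21)) <= 8 * bnd.
  have -> : ((2 * 1) ^ 2)%:R * (P * (Th ^+ 2 * L ^+ 2 * z ^+ 21)) =
      8 * (Th ^+ 2 * L ^+ 2 * z ^+ 11).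
    by rewrite /P; field; rewrite lt0r_neq0.
  rewrite ler_wpM2l// /bnd ler_pM ?mulr_ge0 ?exprn_ge0//; first by rewrite ler_wpM2l.
  by rewrite ler_weXn2l.
have h2' := h2 (mulr_ge0 (ler0n _ 13) bnd0).
have h3' := h3 (size [seq v <- s | ~~ far D w v])%:R; rewrite ler_nat in h3'.
have h4' := h4 (size [seq v <- s | ~~ far 1 w v])%:R; rewrite ler_nat in h4'.
have := h3' (near_count w D); have := h4' (near_count w 1).
rewrite e3; move: h2' e4.
lra.
Qed.

Let cosum x := \sum_(w <- s) weight w * cos (t * mob w x).
Let sisum x := \sum_(w <- s) weight w * sin (t * mob w x).
Let dmob w x : R := (-1) ^+ orient w / lin w x ^+ 2.
Let dco x := \sum_(w <- s) weight w * (- sin (t * mob w x) * (t * dmob w x)).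
Let dsi x := \sum_(w <- s) weight w * (cos (t * mob w x) * (t * dmob w x)).

(** Expansion of [2 B |F|^2 + |F'|^2 / B] into a double sum, by the addition formula for the cosine;
    the two orientation signs multiply to 1. *)
Let amp_cosE x : L^-1 <= x ->
  \sum_(w <- s) weight w * (\sum_(v <- s) weight v *
      (amp w v x * cos (t * (mob w x - mob v x)))) =
  2 * B * (cosum x ^+ 2 + sisum x ^+ 2) + (dco x ^+ 2 + dsi x ^+ 2) / B.
Proof.
move=> x0; have x00 : 0 <= x by rewrite (le_trans _ x0)// invr_ge0.
have row w : w \in s -> \sum_(v <- s) weight v *
      (amp w v x * cos (t * (mob w x - mob v x))) =
    2 * B * (cos (t * mob w x) * cosum x + sin (t * mob w x) * sisum x) +
    (- sin (t * mob w x) * (t * dmob w x) * dco x +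
     cos (t * mob w x) * (t * dmob w x) * dsi x) / B.
  move=> ws; rewrite !mulr_sumr -!big_split/= mulr_sumr mulr_suml -big_split/=.
  rewrite big_seq [RHS]big_seq; apply: eq_bigr => v vs.
  rewrite mulrBr cosB /amp /dmob !s_orient//.
  have sg2 : (-1) ^+ o * (-1) ^+ o = 1 :> R by rewrite -expr2 sqrr_sign.
  have lw := lt0r_neq0 (lin_gt0 w x00); have lv := lt0r_neq0 (lin_gt0 v x00).
  have Bn := lt0r_neq0 B0.
  have t2 : t ^+ 2 = t ^+ 2 * ((-1) ^+ o * (-1) ^+ o) by rewrite sg2 mulr1.
  rewrite t2; move: (lin w x) (lin v x) lw lv => a b a0 b0.
  by move: ((-1) ^+ o) => sg; field; rewrite Bn a0 b0.
rewrite big_seq; under eq_bigr => w ws do rewrite row//.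
rewrite -big_seq !expr2 {2}/cosum {2}/sisum {2}/dco {2}/dsi.
rewrite !mulr_suml -!big_split/= mulr_sumr mulr_suml -big_split/=.
by apply: eq_bigr => w _; ring.
Qed.

(** With [G = |F|^2], AM-GM gives [|G'| <= B |F|^2 + |F'|^2 / B], so [B G + |G'|] is below the
    double sum of [amp_cosE]; this is why [amp] contains [2 B]. Summing [majorant_row] over [w]
    costs nothing, the weights having sum at most 1. *)
Lemma family_antiderivative :
  let G x := (\sum_(w <- s) weight w * cos (t * mob w x)) ^+ 2 +
             (\sum_(w <- s) weight w * sin (t * mob w x)) ^+ 2 in
  exists dG Phi dPhi : R -> R,
  [/\ forall x, L^-1 <= x <= 1 -> is_derive x 1 G (dG x),
      forall x, L^-1 <= x <= 1 -> is_derive x 1 Phi (dPhi x),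
      forall x, L^-1 <= x <= 1 ->
        3 * L ^+ 2 * z ^+ 21 * G x + `|dG x| <= dPhi x &
      Phi 1 - Phi L^-1 <= 125 * (Th ^+ 2 * L ^+ 4 * z ^+ 12)].
Proof.
move=> G.
have w0 v : v \in s -> 0 <= weight v :> R by rewrite ltW// weight_gt0.
have [Phi [dPhi [P1 [P2 P3]]]] := majorant_sum w0 (fun w => @majorant_row w).
have Li0 : 0 < L^-1 by rewrite invr_gt0.
exists (fun x => (dco x * cosum x + cosum x * dco x) +
                 (dsi x * sisum x + sisum x * dsi x)), Phi, dPhi; split => //.
- move=> x /andP[x0 _]; have x00 : 0 <= x by lra.
  have dm w := is_derive_mul (is_derive_const t x) (is_derive_mob w x00).
  have dc : is_derive x 1 cosum (dco x).
    apply: is_derive_bigsum => w.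
    have := is_derive_mul (is_derive_const (weight w) x) (is_derive_cosf (dm w)).
    by rewrite !mul0r !add0r.
  have ds : is_derive x 1 sisum (dsi x).
    apply: is_derive_bigsum => w.
    have := is_derive_mul (is_derive_const (weight w) x) (is_derive_sinf (dm w)).
    by rewrite !mul0r !add0r.
  exact: (is_derive_add (is_derive_mul dc dc) (is_derive_mul ds ds)).
- move=> x x1; apply: le_trans (P2 x x1); rewrite amp_cosE; last by case/andP: x1.
  rewrite -/B /G -/(cosum x) -/(sisum x).
  have amgm (a b : R) : 2 * `|a * b| <= B * b ^+ 2 + a ^+ 2 / B.
    have : 0 <= (B * `|b| - `|a|) ^+ 2 / B by rewrite divr_ge0 ?sqr_ge0 ?ltW.
    have -> : (B * `|b| - `|a|) ^+ 2 / B =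
        B * `|b| ^+ 2 + `|a| ^+ 2 / B - 2 * (`|a| * `|b|).
      by field; rewrite lt0r_neq0.
    by rewrite !real_normK ?num_real// normrM; lra.
  have h1 := amgm (dco x) (cosum x); have h2 := amgm (dsi x) (sisum x).
  have h3 : `|dco x * cosum x + cosum x * dco x + (dsi x * sisum x + sisum x * dsi x)|
      <= 2 * `|dco x * cosum x| + 2 * `|dsi x * sisum x|.
    rewrite [cosum x * _]mulrC [sisum x * _]mulrC (le_trans (ler_normD _ _))//.
    rewrite (_ : dco x * cosum x + _ = 2 * (dco x * cosum x)); last by ring.
    rewrite (_ : dsi x * sisum x + _ = 2 * (dsi x * sisum x)); last by ring.
    by rewrite !(normrM 2) [`|2|]ger0_norm.
  move: h1 h2 h3; lra.
- apply: (le_trans P3); rewrite -mulr_suml -[leRHS]mul1r ler_wpM2r//.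
  by rewrite !mulr_ge0 ?exprn_ge0.
Qed.

End family.

Lemma mob_mono u x y : 0 <= x <= y ->
  if orient u then mob u y <= mob u x else mob u x <= mob u y.
Proof.
move=> /andP[x0 xy]; have y0 : 0 <= y by lra.
have := mobB u y0 x0; case: ifP => _; rewrite ?expr0 ?expr1 => h; rewrite -subr_ge0.
  rewrite -opprB h mulN1r mulNr opprK.
  by rewrite divr_ge0 ?subr_ge0 ?mulr_ge0 ?(ltW (lin_gt0 _ _)).
by rewrite h mul1r divr_ge0 ?subr_ge0 ?mulr_ge0 ?(ltW (lin_gt0 _ _)).
Qed.

(** The cylinders of depth [n] below [u] tile the cylinder of [u] and each has relative mass [2^-n].
    On each, [G] is at most the increment of [Phi], and the increments of a monotone function add
    up. *)
Lemma avg_le_variation (G Phi : R -> R) a n N u : (n <= N)%N ->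
  (forall x y, a <= x -> x <= y -> y <= 1 -> Phi x <= Phi y) ->
  (forall x, 0 <= x <= 1 -> a <= mob u x) ->
  (forall v x, size v = n -> 0 <= x <= 1 ->
    G (mob (v ++ u) x) <= `|Phi (mob (v ++ u) 1) - Phi (mob (v ++ u) 0)|) ->
  avg N (G \o mob u) <= (2 ^+ n)^-1 * `|Phi (mob u 1) - Phi (mob u 0)|.
Proof.
move=> nN mono; elim: n N u nN => [|n IH] N u nN au h.
  rewrite expr0 invr1 mul1r -[leRHS](avg_cst N); apply: le_avg => x x01.
  exact: (h [::] x).
case: N nN => // N nN.
have hl l : avg N (G \o mob (l :: u)) <=
    (2 ^+ n)^-1 * `|Phi (mob (l :: u) 1) - Phi (mob (l :: u) 0)|.
  apply: IH => // [x x01|v x sv x01].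
    exact/au/branch_itv.
  by rewrite -cat_rcons; apply: h; rewrite // size_rcons sv.
have -> : avg N.+1 (G \o mob u) =
  (avg N (G \o mob (false :: u)) + avg N (G \o mob (true :: u))) / 2 by [].
have := hl false; have := hl true.
have -> : mob (false :: u) 1 = mob u (1 + 1)^-1 :> R by rewrite /= mul1r.
have -> : mob (false :: u) 0 = mob u 0 :> R by rewrite /= mul0r.
have -> : mob (true :: u) 1 = mob u (1 + 1)^-1 :> R by [].
have -> : mob (true :: u) 0 = mob u 1 :> R by rewrite /= addr0 invr1.
have i2 : (1 + 1 : R)^-1 = 1 / 2 by field.
rewrite i2.
have m1 : 0 <= (0 : R) <= 1 / 2 by lra.
have m2 : 0 <= (1 / 2 : R) <= 1 by lra.
have a0 : a <= mob u 0 by apply: au; lra.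
have a1 : a <= mob u 1 by apply: au; lra.
have ah : a <= mob u (1 / 2) by apply: au; lra.
have /andP[_ b0] : 0 <= (mob u 0 : R) <= 1 by apply: mob_itv; lra.
have /andP[_ b1] : 0 <= (mob u 1 : R) <= 1 by apply: mob_itv; lra.
have /andP[_ bh] : 0 <= (mob u (1 / 2) : R) <= 1 by apply: mob_itv; lra.
(* The two branches map [0, 1] onto [0, 1/2] and [1/2, 1], so the two subcylinders meet at
   [mob u (1/2)]. *)
have e : `|Phi (mob u (1 / 2)) - Phi (mob u 0)| + `|Phi (mob u (1 / 2)) - Phi (mob u 1)|
    = `|Phi (mob u 1) - Phi (mob u 0)|.
  have := mob_mono u m1; have := mob_mono u m2; case: ifP => _ h1 h2.
    have p1 := mono _ _ a1 h1 bh; have p2 := mono _ _ ah h2 b0.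
    have p3 := le_trans p1 p2.
    rewrite ler0_norm ?subr_le0// ger0_norm ?subr_ge0// ler0_norm ?subr_le0//.
    by ring.
  have p1 := mono _ _ a0 h2 bh; have p2 := mono _ _ ah h1 b1.
  have p3 := le_trans p1 p2.
  rewrite ger0_norm ?subr_ge0// ler0_norm ?subr_le0// ger0_norm ?subr_ge0//.
  by ring.
rewrite -e exprS invfM mulrDr; set c := (2 ^+ n)^-1; lra.
Qed.

End mean_square.

(** * Cylinder lengths and the mean square over the whole interval *)

Section decay.
Local Open Scope classical_set_scope.
Local Open Scope ring_scope.
Context {R : realType}.
Implicit Types (x : R) (u v w : seq bool).

Lemma brow_nseq k : brow (nseq k false) = (k, 1%N).
Proof. by elim: k => //= k ->; rewrite addn1. Qed.

(** In the coordinate [1/x], the branch [x/(1+x)] is translation by 1. *)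
Lemma mob_nseq_ge k i x : (0 < i)%N -> i%:R^-1 <= x ->
  (i + k)%:R^-1 <= mob (nseq k false) x.
Proof.
elim: k i x => [|k IH] i x i0 ix; first by rewrite addn0.
rewrite addnS -addSn; apply: IH => //=.
have ip : 0 < i%:R :> R by rewrite ltr0n.
have x0 : 0 < x by apply: lt_le_trans ix; rewrite invr_gt0.
rewrite -natr1 -[leLHS]mul1r ler_pdivrMr; last by lra.
rewrite mulrAC ler_pdivlMr; last by lra.
have : 1 <= x * i%:R by rewrite -ler_pdivrMr// mul1r.
lra.
Qed.

Lemma growth_pow10 (n j : nat) : (n <= 10 * j)%N ->
  growth ^+ n <= (2 ^+ (7 * j) : R).
Proof.
move=> nj; have g1 : 1 <= growth :> R by rewrite /growth; lra.
apply: (@le_trans _ _ (growth ^+ (10 * j))); first by rewrite ler_weXn2l.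
have g0 : 0 <= growth :> R by lra.
rewrite exprM [X in _ <= X]exprM lerXn2r ?nnegrE ?exprn_ge0//.
by rewrite /growth; lra.
Qed.

(** The length is the reciprocal of [den] times the second row entry. The word
    [true :: nseq k false] has row [(1, k+1)], and the [15 j] further letters multiply this product
    by at most [growth^(30 j + 1)], where [growth^(30 j) <= 2^(21 j)] and [growth <= 3]. *)
Lemma mob_length_ge (k j : nat) (L : R) v : k.+2%:R <= L ->
  size v = (15 * j)%N ->
  (3 * L ^+ 2 * (2 ^+ j) ^+ 21)^-1 <=
  `|mob (v ++ true :: nseq k false) 1 - mob (v ++ true :: nseq k false) 0|.
Proof.
move=> kL sv; pose u := true :: nseq k false.
have k1 : 1 <= k.+2%:R :> R by rewrite ler1n.
have k0 : 0 <= k.+2%:R :> R by rewrite ler0n.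
have g1 : 1 <= growth :> R by rewrite /growth; lra.
have [||||_ h2 h3] := @brow_growth R k.+2%:R u v.
- exact: k0.
- by rewrite /u/= brow_nseq ler_nat.
- by rewrite /u/= brow_nseq /= addn1 ler_nat.
- rewrite /u/den/= brow_nseq/= (_ : (1 + (k + 1) = k.+2)%N); last by lia.
  by rewrite ler_peMr.
rewrite mob10_norm lef_pV2 ?posrE; last 2 first.
- by rewrite !mulr_gt0 ?exprn_gt0//; lra.
- rewrite mulr_gt0 ?ltr0n ?brow2_gt0// (leq_ltn_trans _ (size_den _))//.
apply: le_trans (ler_pM _ _ h3 h2) _; rewrite ?ler0n// sv.
have -> : k.+2%:R * growth ^+ (15 * j).+1 * (k.+2%:R * growth ^+ (15 * j)) =
   k.+2%:R ^+ 2 * growth * growth ^+ (10 * (3 * j)) :> R.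
  rewrite exprS (_ : (10 * (3 * j) = 15 * j + 15 * j)%N); last by lia.
  by rewrite exprD; ring.
have -> : (2 ^+ j) ^+ 21 = 2 ^+ (7 * (3 * j)) :> R.
  by rewrite -exprM; congr (_ ^+ _); lia.
have kk : k.+2%:R ^+ 2 <= L ^+ 2 by rewrite ler_sqr ?nnegrE//; lra.
rewrite ler_pM ?growth_pow10// ?mulr_ge0 ?exprn_ge0//; try lra.
rewrite [3 * _]mulrC ler_pM ?sqr_ge0//; rewrite /growth; lra.
Qed.

(** For [i = 0], the interval [0, 1] is cut into the cylinders [1/(k+2), 1/(k+1)] of
    [true :: nseq k false] for [k < m] and the remaining one next to 0, which has mass [2^-m] and
    where only [G <= 1] is used. *)
Lemma avg_split_nseq (G : R -> R) Y m N i : (i <= m)%N ->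
  (forall x, 0 <= x <= 1 -> G x <= 1) -> 0 <= Y ->
  (forall k n, (k < m)%N -> (N <= n)%N ->
     avg n (G \o mob (true :: nseq k false)) <= Y) ->
  forall n, (N + (m - i) <= n)%N ->
  avg n (G \o mob (nseq i false)) <= Y + (2 ^+ (m - i))^-1.
Proof.
move=> im G1 Y0 h; move e : (m - i)%N => d; elim: d i im e => [|d IH] i im e n Nn.
  rewrite expr0 invr1 -[leRHS](avg_cst n); apply: le_avg => x x01 /=.
  by rewrite ler_wpDl// G1// mob_itv.
case: n Nn => [|n] Nn; first by lia.
have -> : avg n.+1 (G \o mob (nseq i false)) =
  (avg n (G \o mob (nseq i.+1 false)) + avg n (G \o mob (true :: nseq i false))) / 2.
  by [].
have : avg n (G \o mob (nseq i.+1 false)) <= Y + (2 ^+ d)^-1 by apply: IH; lia.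
have : avg n (G \o mob (true :: nseq i false)) <= Y by apply: h; lia.
rewrite exprS invfM; set c := (2 ^+ d)^-1; lra.
Qed.

Lemma trig_sums_le1 (I : Type) (s : seq I) (p : I -> R) (a : I -> R) :
  (forall i, 0 <= p i) -> \sum_(i <- s) p i <= 1 ->
  (\sum_(i <- s) p i * cos (a i)) ^+ 2 +
  (\sum_(i <- s) p i * sin (a i)) ^+ 2 <= 1.
Proof.
move=> p0 p1; rewrite !expr2 !mulr_suml -big_split/=.
rewrite (le_trans _ p1)//; apply: ler_sum => i _.
rewrite !mulr_sumr -big_split/= -[leRHS]mulr1.
have -> : \sum_(k <- s) (p i * cos (a i) * (p k * cos (a k)) +
    p i * sin (a i) * (p k * sin (a k))) =
    p i * \sum_(k <- s) p k * cos (a i - a k).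
  by rewrite mulr_sumr; apply: eq_bigr => k _; rewrite cosB; ring.
rewrite ler_wpM2l// (le_trans _ p1)//; apply: ler_sum => k _.
by rewrite ler_piMr// cos_le1.
Qed.

(** The cylinders of depth [15 j] inside that of [true :: nseq k false] turn the bound [z^12] of
    [family_antiderivative] into [z^12 / z^15]; the piece next to 0, of mass [2^(-2 j)], gives
    [1 / z^2]. Together they use at most [17 j] letters. *)
Lemma avg_family_le (t Th : R) (j : nat) (s : seq (seq bool)) (o : bool) :
  let z : R := 2 ^+ j in let L : R := (2 * j).+1%:R in
  100 <= Th -> z ^+ 35 <= `|t| -> `|t| <= Th * z ^+ 35 -> uniq s ->
  (forall w, w \in s -> orient w = o) ->
  (forall w, w \in s -> (2 ^ (7 * j) <= den w <= 2 * 2 ^ (7 * j))%N) ->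
  (forall w, w \in s -> weight w <= 2 / z ^+ 10) ->
  \sum_(w <- s) weight w <= 1 :> R ->
  forall N, (17 * j <= N)%N ->
  avg N (fun x => (\sum_(w <- s) weight w * cos (t * mob w x)) ^+ 2 +
                  (\sum_(w <- s) weight w * sin (t * mob w x)) ^+ 2)
  <= 125 * Th ^+ 2 * L ^+ 4 / z ^+ 3 + (z ^+ 2)^-1.
Proof.
move=> z L Th1 tz tTz s1 s2 s3 s4 s5 N jN.
have jN' : (15 * j + (2 * j - 0) <= N)%N by clear -jN; lia.
have zE : z = 2 ^+ j by []. have LE : L = (2 * j).+1%:R by [].
clearbody z L.
have z0 : 0 < z by rewrite zE exprn_gt0.
have L1 : 1 <= L by rewrite LE ler1n.
have L0 : 0 < L by lra.
have Li0 : 0 < L^-1 by rewrite invr_gt0.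
have Li1 : L^-1 <= 1 by rewrite invf_le1.
have [dG [Phi [dPhi [hG hPhi hle hb]]]] := @family_antiderivative R z L Th t j
  zE L1 Th1 tz tTz s o s1 s2 s3 s4 s5.
set G := (fun x => _ + _).
have G0 x : 0 <= G x by rewrite addr_ge0 ?sqr_ge0.
have G1 x : 0 <= x <= 1 -> G x <= 1.
  by move=> _; apply: trig_sums_le1 => // w; rewrite ltW// weight_gt0.
have B0 : 0 < 3 * L ^+ 2 * z ^+ 21 by rewrite !mulr_gt0// exprn_gt0.
have Phim x y : L^-1 <= x -> x <= y -> y <= 1 -> Phi x <= Phi y.
  apply: derive_ge0_le hPhi _ x y => x x1; apply: le_trans (hle x x1).
  by rewrite addr_ge0// mulr_ge0 ?G0// ltW.
pose Y := 125 * (Th ^+ 2 * L ^+ 4 * z ^+ 12) / z ^+ 15.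
have -> : 125 * Th ^+ 2 * L ^+ 4 / z ^+ 3 = Y by rewrite /Y; field; rewrite lt0r_neq0.
have Y0 : 0 <= Y.
  have h1 := ltW z0; have h2 := ltW L0; have h3 : 0 <= Th by lra.
  by rewrite divr_ge0 ?exprn_ge0// !mulr_ge0 ?exprn_ge0.
have -> : z ^+ 2 = 2 ^+ (2 * j - 0) by rewrite subn0 zE -exprM mulnC.
apply: (@avg_split_nseq G Y (2 * j) (15 * j) 0 (leq0n _) G1 Y0 _ N jN').
move=> k n kj jn.
(* This fixes [L = 2 j + 1]: for [k < 2 j] the cylinder lies in [1/L, 1]. *)
have kL : k.+2%:R <= L by rewrite LE ler_nat ltnS.
have au (x : R) : 0 <= x <= 1 -> L^-1 <= mob (true :: nseq k false) x.
  move=> /andP[x0 x1]; apply: (@le_trans _ _ (2 + k)%:R^-1).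
    by rewrite lef_pV2 ?posrE ?ltr0n.
  by apply: mob_nseq_ge => //=; rewrite lef_pV2 ?posrE//; lra.
apply: (le_trans (avg_le_variation jn Phim au _)).
- move=> v x sv x01; set u := v ++ _.
  have auv (y : R) : 0 <= y <= 1 -> L^-1 <= mob u y <= 1.
    move=> y01; have /andP[_ ->] := mob_itv u y01; rewrite andbT /u.
    by elim: (v) y y01 => [|l v' IH] y y01; [exact: au|apply/IH/branch_itv].
  have hlen : (3 * L ^+ 2 * z ^+ 21)^-1 <= `|mob u 1 - mob u 0|.
    by rewrite zE; exact: mob_length_ge kL sv.
  have /andP[x0 x1] := x01.
  have p0 : 0 <= (0 : R) <= x by rewrite lexx.
  have p1 : 0 <= x <= 1 by [].
  have /andP[l0 r0] := auv 0 ltac:(lra); have /andP[l1 r1] := auv 1 ltac:(lra).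
  have := @mob_mono R u x 1 x01; have := @mob_mono R u 0 x p0.
  case: ifP => _ m1 m2.
    rewrite ler0_norm ?subr_le0 ?(le_trans m2)// in hlen.
    rewrite ler0_norm ?subr_le0 ?Phim ?(le_trans m2)// opprB.
    apply: (@gallagher _ G dG Phi dPhi (3 * L ^+ 2 * z ^+ 21)) => //.
    + by rewrite opprB in hlen.
    + by move=> y /andP[? ?]; apply: hG; rewrite (le_trans l1)//=; lra.
    + by move=> y /andP[? ?]; apply: hPhi; rewrite (le_trans l1)//=; lra.
    + by move=> y /andP[? ?]; apply: hle; rewrite (le_trans l1)//=; lra.
    + by rewrite m1 m2.
  rewrite ger0_norm ?subr_ge0 ?(le_trans m1)// in hlen.
  rewrite ger0_norm ?subr_ge0 ?Phim ?(le_trans m1)//.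
  apply: (@gallagher _ G dG Phi dPhi (3 * L ^+ 2 * z ^+ 21)) => //.
  + by move=> y /andP[? ?]; apply: hG; rewrite (le_trans l0)//=; lra.
  + by move=> y /andP[? ?]; apply: hPhi; rewrite (le_trans l0)//=; lra.
  + by move=> y /andP[? ?]; apply: hle; rewrite (le_trans l0)//=; lra.
  + by rewrite m1 m2.
have -> : 2 ^+ (15 * j) = z ^+ 15 by rewrite zE -exprM mulnC.
rewrite mulrC /Y ler_wpM2r ?invr_ge0 ?exprn_ge0 ?(ltW z0)//.
apply: le_trans hb.
have a0 := au 0 ltac:(lra); have a1 := au 1 ltac:(lra).
have /andP[_ b0] : 0 <= (mob (true :: nseq k false) 0 : R) <= 1 by apply: mob_itv; lra.
have /andP[_ b1] : 0 <= (mob (true :: nseq k false) 1 : R) <= 1 by apply: mob_itv; lra.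
have := Phim _ _ (lexx _) a0 b0; have := Phim _ _ (lexx _) a1 b1.
have := Phim _ _ a0 b0 (lexx _); have := Phim _ _ a1 b1 (lexx _).
by rewrite ler_norml; lra.
Qed.

End decay.

(** * Decay of the averages *)

Section trig.
Local Open Scope classical_set_scope.
Local Open Scope ring_scope.
Context {R : realType}.
Implicit Types (x : R) (u v w : seq bool).

Lemma lipschitz_of_derive (f df : R -> R) : (forall x, is_derive x 1 f (df x)) ->
  (forall x, `|df x| <= 1) -> forall x y, `|f x - f y| <= `|x - y|.
Proof.
move=> fd df1; suff h x y : x <= y -> `|f x - f y| <= `|x - y|.
  move=> x y; have [xy|/ltW yx] := leP x y; first exact: h.
  by rewrite distrC [leRHS]distrC h.
move=> xy; rewrite [`|x - y|]distrC (ger0_norm (_ : 0 <= y - x)) ?subr_ge0//.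
have m1 := @derive_ge0_le R (fun z => z - f z) (fun z => 1 - df z) x y
  (fun z _ => is_derive_sub (is_derive_var z) (fd z)) _ x y (lexx _) xy (lexx _).
have m2 := @derive_ge0_le R (fun z => z + f z) (fun z => 1 + df z) x y
  (fun z _ => is_derive_add (is_derive_var z) (fd z)) _ x y (lexx _) xy (lexx _).
have : x - f x <= y - f y.
  by apply: m1 => z _; have := df1 z; rewrite ler_norml; lra.
have : x + f x <= y + f y.
  by apply: m2 => z _; have := df1 z; rewrite ler_norml; lra.
by rewrite ler_norml; lra.
Qed.

Lemma cos_lipschitz x y : `|cos x - cos y| <= `|x - y|.
Proof.
apply: (@lipschitz_of_derive _ (fun z => - sin z)) => z.
by rewrite normrN ler_norml sin_geN1 sin_le1.
Qed.

Lemma sin_lipschitz x y : `|sin x - sin y| <= `|x - y|.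
Proof.
apply: (@lipschitz_of_derive _ cos) => z.
by rewrite ler_norml cos_geN1 cos_le1.
Qed.

(** Reaching [den w >= 2^(7 j) >= growth^(10 j)] takes at least [10 j - 1] letters, since
    [den w <= growth^(size w + 1)]. *)
Lemma stop_weight_le (j : nat) w : w \in stop (2 ^ (7 * j)) (2 ^ (7 * j)) [::] ->
  weight w <= 2 / (2 ^+ j) ^+ 10 :> R.
Proof.
move=> ws; have /= := @stop_ge (2 ^ (7 * j)) (2 ^ (7 * j)) [::] w (leq_addl _ _) ws.
rewrite -(ler_nat R) natrX => /le_trans/(_ (den_le_growth w)) h.
have g1 : 1 < growth :> R by rewrite /growth; lra.
have hw : (10 * j <= (size w).+1)%N.
  rewrite leqNgt; apply/negP => lt.
  have := @growth_pow10 R _ j (leqnn _).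
  have : growth ^+ (size w).+1 < growth ^+ (10 * j) :> R by rewrite ltr_eXn2l.
  lra.
rewrite /weight -exprM [(j * 10)%N]mulnC.
rewrite ler_pdivlMr ?exprn_gt0// mulrC ler_pdivrMr ?exprn_gt0// -exprS.
by rewrite ler_eXn2l ?ltr1n.
Qed.

Lemma avg_trig_approx (t Th : R) (j N : nat) :
  let z : R := 2 ^+ j in let L : R := (2 * j).+1%:R in
  100 <= Th -> z ^+ 35 <= `|t| -> `|t| <= Th * z ^+ 35 -> (17 * j <= N)%N ->
  exists a b : R,
  [/\ `|avg N (fun x => cos (t * x)) - a| <= (2 ^ (7 * j))%:R * (`|t| / N.+1%:R),
      `|avg N (fun x => sin (t * x)) - b| <= (2 ^ (7 * j))%:R * (`|t| / N.+1%:R) &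
      a ^+ 2 + b ^+ 2 <= 4 * (125 * Th ^+ 2 * L ^+ 4 / z ^+ 3 + (z ^+ 2)^-1)].
Proof.
move=> z L Th1 tz tTz jN.
pose Q := (2 ^ (7 * j))%N; pose S := stop Q Q [::].
have Lc : lipschitz01 `|t| (fun x => cos (t * x)).
  by move=> x y _ _; rewrite (le_trans (cos_lipschitz _ _))// -mulrBr normrM.
have Ls : lipschitz01 `|t| (fun x => sin (t * x)).
  by move=> x y _ _; rewrite (le_trans (sin_lipschitz _ _))// -mulrBr normrM.
pose C x := \sum_(w <- S) weight w * cos (t * mob w x).
pose D x := \sum_(w <- S) weight w * sin (t * mob w x).
have hC := avg_stop N Q Q [::] (normr_ge0 t) Lc.
have hD := avg_stop N Q Q [::] (normr_ge0 t) Ls.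
have w1 : weight [::] = 1 :> R by rewrite /weight expr0 invr1.
rewrite w1 !mul1r in hC hD.
have avgE (F : R -> R) : avg N (fun x => \sum_(w <- S) weight w * F (mob w x)) =
    \sum_(w <- S) weight w * avg N (F \o mob w).
  by rewrite avg_sum; apply: eq_bigr => w _; rewrite avgZ.
exists (avg N C), (avg N D); split; [by rewrite (avgE (fun x => cos (t * x)))|
  by rewrite (avgE (fun x => sin (t * x)))|].
(* The mean-square bound needs a common orientation, so the stopping words form two families. Using
   [(a + b)^2 <= 2 (a^2 + b^2)] for two families produces the factor 4. *)
pose s o := [seq w <- S | orient w == o].
pose Cs o x := \sum_(w <- s o) weight w * cos (t * mob w x).
pose Ds o x := \sum_(w <- s o) weight w * sin (t * mob w x).
have split_orient (F : seq bool -> R) :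
    \sum_(w <- S) F w = \sum_(w <- s true) F w + \sum_(w <- s false) F w.
  rewrite !big_filter (bigID (fun w => orient w == true))/=; congr (_ + _).
  by apply: eq_bigl => w; case: orient.
have bnd o : avg N (Cs o) ^+ 2 + avg N (Ds o) ^+ 2 <=
    125 * Th ^+ 2 * L ^+ 4 / z ^+ 3 + (z ^+ 2)^-1.
  have h := @avg_family_le R t Th j (s o) o Th1 tz tTz.
  apply: le_trans (lerD (sqr_avg_le _ _) (sqr_avg_le _ _)) _; rewrite -avgD.
  apply: h => //.
  - by rewrite filter_uniq// stop_uniq.
  - by move=> w; rewrite mem_filter => /andP[/eqP].
  - move=> w; rewrite mem_filter => /andP[_ ws]; apply/andP; split.
      exact: stop_ge (leq_addl _ _) ws.
    by apply: stop_le ws; rewrite muln_gt0 expn_gt0.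
  - by move=> w; rewrite mem_filter => /andP[_ ws]; exact: stop_weight_le.
  - rewrite -w1 -(sum_weight_stop Q Q) -/S split_orient.
    have w0 o' : 0 <= \sum_(w <- s o') weight w :> R.
      by apply: sumr_ge0 => w _; rewrite ltW// weight_gt0.
    by case: (o); [rewrite lerDl|rewrite lerDr].
have -> : avg N C = avg N (Cs true) + avg N (Cs false).
  by rewrite -avgD; apply: eq_avg => x _; exact: split_orient.
have -> : avg N D = avg N (Ds true) + avg N (Ds false).
  by rewrite -avgD; apply: eq_avg => x _; exact: split_orient.
have sqD (a b : R) : (a + b) ^+ 2 <= 2 * (a ^+ 2 + b ^+ 2).
  by rewrite -subr_ge0 (_ : _ - _ = (a - b) ^+ 2) ?sqr_ge0//; ring.
apply: le_trans (lerD (sqD _ _) (sqD _ _)) _.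
have := bnd true; have := bnd false.
move: (_ / _ + _) (avg N (Cs true) ^+ 2) (avg N (Cs false) ^+ 2)
  (avg N (Ds true) ^+ 2) (avg N (Ds false) ^+ 2) => Y a b c d; lra.
Qed.

End trig.

(** * The Minkowski measure and averages over words *)

Section integral.
Local Open Scope classical_set_scope.
Local Open Scope ring_scope.
Context {R : realType}.
Implicit Types (a b c x y : R) (u : seq bool) (f : R -> R).

Local Notation minkowski := (@Defs.minkowski R).

(** For [y > 0], [y/(1+y)] is the reciprocal of [1/y + 1], so it has the expansion of [y] with first
    partial quotient raised by 1; [1/(1+y)] puts a new partial quotient 1 in front of that of
    [y]. *)
Lemma minkowski_branch (l : bool) y : 0 <= y <= 1 ->
  minkowski (branch l y) =
  if l then 1 - minkowski y / 2 else minkowski y / 2.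
Proof.
move=> /andP[y0 y1]; case: l => /=.
  rewrite (@minkowski_rec_itv R _ 1)//; last by rewrite invrK; lra.
  by rewrite invrK expr1 [1 + y]addrC addrK; field.
have [->|yn0] := eqVneq y 0; first by rewrite mul0r minkowski0 mul0r.
have yp : 0 < y by rewrite lt_neqAle eq_sym yn0.
have yi : 1 <= y^-1 by rewrite invf_ge1.
have /andP[k1 k2] := truncn_itv (le_trans ler01 yi).
have k0 : (0 < Num.truncn y^-1)%N by rewrite truncn_gt0.
move: k0 k1 k2; set k := Num.truncn _ => k0 k1 k2.
have e : (y / (1 + y))^-1 = y^-1 + 1.
  by field; rewrite yn0 lt0r_neq0//; lra.
rewrite (@minkowski_rec_itv R _ k.+1)//; last first.
  by rewrite e -!natr1; move: k2; rewrite -natr1; lra.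
rewrite (@minkowski_rec_itv R y k) ?k1 ?(ltW k2)// e -[k.+1%:R]natr1.
rewrite (_ : y^-1 + 1 - (k%:R + 1) = y^-1 - k%:R); last by ring.
by rewrite exprS invfM; ring.
Qed.

Lemma minkowski_mob u : exists e s : R, (s = 1 \/ s = -1) /\
  forall y, 0 <= y <= 1 -> minkowski (mob u y) = e + s * weight u * minkowski y.
Proof.
elim: u => [|l u [e [s [s1 IH]]]].
  exists 0, 1; split; first by left.
  by move=> y _; rewrite /weight expr0 invr1 mulr1 mul1r add0r.
case: l.
  exists (e + s * weight u), (- s); split; first by case: s1 => ->; [right|left; ring].
  move=> y y01; rewrite [mob _ _]/= -/(branch true y) IH; last exact: (branch_itv true).
  by rewrite minkowski_branch// weight_cons; field.
exists e, s; split => // y y01.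
rewrite [mob _ _]/= -/(branch false y) IH; last exact: (branch_itv false).
by rewrite minkowski_branch// weight_cons; field.
Qed.

Lemma minkowski_mob10 u :
  `|minkowski (mob u 1) - minkowski (mob u 0)| = weight u :> R.
Proof.
have [e [s [s1 h]]] := minkowski_mob u.
rewrite !h ?lexx ?ler01// minkowski0 minkowski1.
have w0 : 0 < weight u :> R := weight_gt0 u.
rewrite (_ : _ - _ = s * weight u); last by ring.
by rewrite normrM (gtr0_norm w0); case: s1 => ->; rewrite ?normrN normr1 mul1r.
Qed.

Local Notation mu := (lebesgue_stieltjes_measure (@minkowski_cdf R)).

Lemma mu_oc a b : a <= b -> mu `]a, b] = (minkowski_cdf b - minkowski_cdf a)%:E.
Proof.
move=> ab; rewrite /lebesgue_stieltjes_measure /measure_extension.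
rewrite measurable_mu_extE/=; last exact: is_ocitv.
by rewrite wlength_itv_bnd.
Qed.

Lemma integrable_mu f M (D : set R) :
  measurable (D : set (measurableTypeR R)) ->
  continuous f -> (forall x, `|f x| <= M) -> mu.-integrable D (EFin \o f).
Proof.
move=> mD cf fM; apply: measurable_bounded_integrable => //.
- by rewrite (le_lt_trans (probability_le1 mu mD))// ltry.
- by apply: measurable_funS (measurable_realfun.continuous_measurable_fun cf).
- exists M; split; first exact: num_real.
  by move=> K MK x _; rewrite /= (le_trans (fM x))// ltW.
Qed.

(** Cylinders are half-open and miss 0, which must therefore carry no mass; the distribution
    function vanishes on [-1, 0]. *)
Lemma mu_set0 : mu [set 0] = 0%E.
Proof.
apply/eqP; rewrite eq_le measure_ge0 andbT.
have -> : 0%E = mu `]-1, 0].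
  rewrite mu_oc; last by lra.
  by rewrite !minkowski_cdf0 ?subrr//; lra.
apply: le_measure; rewrite ?inE//=.
by move=> x /= ->; rewrite in_itv/= lexx andbT; lra.
Qed.

Lemma integral_oc_near f c a b y : lipschitz01 c f -> continuous f ->
  (forall x, `|f x| <= 1) -> 0 <= c -> 0 <= a -> b <= 1 -> a <= y <= b ->
  `|\int[mu]_(x in `]a, b]) f x - (minkowski_cdf b - minkowski_cdf a) * f y|
  <= (minkowski_cdf b - minkowski_cdf a) * (c * (b - a)).
Proof.
move=> lf cf f1 c0 a0 b1 /andP[ay yb]; have ab : a <= b by lra.
have muE := mu_oc ab.
have mD : measurable (`]a, b] : set (measurableTypeR R)) by [].
have if1 := integrable_mu mD cf f1.
have cfy : continuous (fun x => f x - f y).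
  by move=> x; apply: cvgB; [exact: cf|exact: cvg_cst].
have ify := integrable_mu mD cfy (fun x => le_trans (ler_normB _ _) (lerD (f1 x) (f1 y))).
have ic k : mu.-integrable `]a, b] (EFin \o (fun=> k : R)).
  exact: (@integrable_mu (fun=> k) `|k| _ mD (fun x => cvg_cst k) (fun=> lexx _)).
have cstE r : \int[mu]_(_ in `]a, b]) r = r * (minkowski_cdf b - minkowski_cdf a).
  by rewrite Rintegral_cst//; congr (_ * _); exact: (congr1 fine muE).
have -> : \int[mu]_(x in `]a, b]) f x - (minkowski_cdf b - minkowski_cdf a) * f y =
    \int[mu]_(x in `]a, b]) (f x - f y).
  by rewrite RintegralB// cstE [f y * _]mulrC.
apply: (le_trans (le_normr_Rintegral _ _)) => //.
rewrite mulrC -cstE; apply: le_Rintegral => //; first exact: (integrable_norm ify).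
move=> x /=; rewrite in_itv/= => /andP[ax xb].
apply: (le_trans (lf x y _ _)); rewrite ?ler_wpM2l//; try lra.
by rewrite ler_norml; lra.
Qed.

(** Minimum and maximum are taken because [mob u] may be decreasing; half-open intervals make the
    two subcylinders disjoint. *)
Definition cylinder u : set R :=
  `]Num.min (mob u 0) (mob u 1), Num.max (mob u 0) (mob u 1)].

(** Both sides split along the two subcylinders, so the induction descends to depth [n + size u].
    There [f] is within [c] times the length of the cylinder of its value at [mob u 0], and the mass
    is [weight u]. *)
Lemma integral_cylinder_near f c n u : lipschitz01 c f -> continuous f ->
  (forall x, `|f x| <= 1) -> 0 <= c ->
  `|\int[mu]_(x in cylinder u) f x - weight u * avg n (f \o mob u)|
  <= weight u * (c / (n + size u).+1%:R).
Proof.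
move=> lf cf f1 c0; elim: n u => [|n IH] u.
  have y01 : 0 <= (0 : R) <= 1 by rewrite lexx ler01.
  have o01 : 0 <= (1 : R) <= 1 by rewrite lexx ler01.
  have m0 := mob_itv u y01; have m1 := mob_itv u o01.
  rewrite [avg _ _]/= add0n.
  suff h a b : a <= b -> 0 <= a <= 1 -> 0 <= b <= 1 -> a = mob u 0 \/ b = mob u 0 ->
      b - a = `|mob u 1 - mob u 0| ->
      minkowski_cdf b - minkowski_cdf a = weight u ->
      `|\int[mu]_(x in `]a, b]) f x - weight u * f (mob u 0)| <=
      weight u * (c / (size u).+1%:R).
    have hw := minkowski_mob10 u.
    have [/andP[m00 m01] /andP[m10 m11]] := (m0, m1).
    rewrite /cylinder; have [le|/ltW le] := leP (mob u 0) (mob u 1).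
      apply: h => //; [by left|by rewrite ger0_norm ?subr_ge0|].
      by rewrite -hw !minkowski_cdfE// ger0_norm// subr_ge0 minkowski_homo.
    apply: h => //; [by right|by rewrite ler0_norm ?subr_le0// opprB|].
    by rewrite -hw !minkowski_cdfE// ler0_norm ?opprB// subr_le0 minkowski_homo.
  move=> ab /andP[a0 _] /andP[_ b1] hab hba hw.
  have ym : a <= mob u 0 <= b by case: hab => <-; rewrite lexx ab.
  have := integral_oc_near lf cf f1 c0 a0 b1 ym; rewrite hw => /le_trans; apply.
  rewrite ler_wpM2l ?(ltW (weight_gt0 _))// ler_wpM2l// hba; exact: mob10_le.
have -> : avg n.+1 (f \o mob u) =
  (avg n (f \o mob (false :: u)) + avg n (f \o mob (true :: u))) / 2 by [].
have e : \int[mu]_(x in cylinder u) f x = \int[mu]_(x in cylinder (false :: u)) f x +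
   \int[mu]_(x in cylinder (true :: u)) f x.
  have i2 : (1 + 1 : R)^-1 = 1 / 2 by field.
  have c1 : cylinder (false :: u) =
      `]Num.min (mob u 0) (mob u (1 / 2)), Num.max (mob u 0) (mob u (1 / 2))]%classic.
    by rewrite /cylinder/= mul0r -[in RHS]i2 mul1r.
  have c2 : cylinder (true :: u) =
      `]Num.min (mob u 1) (mob u (1 / 2)), Num.max (mob u 1) (mob u (1 / 2))]%classic.
    by rewrite /cylinder/= addr0 invr1 -i2.
  rewrite c1 c2 /cylinder.
  have glue a b d : a <= b -> b <= d -> \int[mu]_(x in `]a, d]) f x =
      \int[mu]_(x in `]a, b]) f x + \int[mu]_(x in `]b, d]) f x.
    move=> ab bd; rewrite (@itv_bndbnd_setU _ _ _ (BRight b)) ?bnd_simp//.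
    apply: Rintegral_setU => //.
      by apply: (integrable_mu _ cf f1); exact: measurableU.
    apply/disj_set2P; rewrite -subset0 => x [] /=; rewrite !in_itv/=.
    by move=> /andP[_ xb] /andP[bx _]; lra.
  have p1 : 0 <= (0 : R) <= 1 / 2 by lra.
  have p2 : 0 <= (1 / 2 : R) <= 1 by lra.
  have := mob_mono u p1; have := mob_mono u p2; case: ifP => _ h2 h1.
    have h3 := le_trans h2 h1.
    by rewrite (min_r h3) (max_l h3) (min_r h1) (max_l h1) (min_l h2) (max_r h2) addrC;
       exact: glue.
  have h3 := le_trans h1 h2.
  by rewrite (min_l h3) (max_r h3) (min_l h1) (max_r h1) (min_r h2) (max_l h2); exact: glue.
have := IH (false :: u); have := IH (true :: u); rewrite !weight_cons e.
rewrite [size _]/= addnS addSn; set c' := c / _.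
have w0 : 0 < weight u :> R := weight_gt0 u.
by rewrite !ler_norml; lra.
Qed.

Lemma integral_avg_near f c n : lipschitz01 c f -> continuous f ->
  (forall x, `|f x| <= 1) -> 0 <= c ->
  `|\int[mu]_(x in `[0, 1]) f x - avg n f| <= c / n.+1%:R.
Proof.
move=> lf cf f1 c0; have := integral_cylinder_near n [::] lf cf f1 c0.
have c01 : cylinder [::] = `]0, 1]%classic.
  by rewrite /cylinder/= min_l ?max_r.
have m1 : measurable ([set 0] : set (measurableTypeR R)) by exact: measurable_set1.
have m2 : measurable (`]0, 1] : set (measurableTypeR R)) by [].
have e01 : [set 0] `|` `]0, 1] = `[0, 1]%classic :> set R.
  by rewrite (@setU1itv _ _ _ 0 false)// bnd_simp.
have e : \int[mu]_(x in `[0, 1]) f x = \int[mu]_(x in `]0, 1]) f x.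
  rewrite -e01 Rintegral_setU//.
  - rewrite {1}/Rintegral null_set_integral ?add0r//; last exact: mu_set0.
    exact: (measurable_int mu (integrable_mu m1 cf f1)).
  - by apply: (integrable_mu _ cf f1); exact: measurableU.
  - apply/disj_set2P; rewrite -subset0 => x [] /= ->.
    by rewrite in_itv/= ltxx.
by rewrite /weight expr0 invr1 !mul1r addn0 c01 e.
Qed.

End integral.

(** * Passage to the limit and choice of the scale *)

Section final.
Local Open Scope classical_set_scope.
Local Open Scope ring_scope.
Context {R : realType}.
Local Notation mu := (lebesgue_stieltjes_measure (@minkowski_cdf R)).

Lemma poly4_le_exp2 j : ((2 * j).+1 ^ 4 <= 1000 * 2 ^ j)%N.
Proof.
have [|j5] := ltnP j 5; first by case: j => [|[|[|[|[|]]]]].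
rewrite -(subnKC j5); elim: (j - 5)%N => [//|k IH].
rewrite addnS [(2 ^ _.+1)%N]expnS mulnCA; apply: leq_trans (leq_mul (leqnn 2) IH).
(* From [j = 5] on, consecutive bases have ratio at most 13/11, and [(13/11)^2 <= 7/5],
   [(7/5)^2 <= 2], so the fourth power at most doubles. *)
have : (11 * (2 * (5 + k).+1).+1 <= 13 * (2 * (5 + k)).+1)%N by clear; lia.
move: (2 * (5 + k).+1).+1 (2 * (5 + k)).+1 => a b ab.
have h2 : (5 * a ^ 2 <= 7 * b ^ 2)%N.
  by move: ab; rewrite -(leq_exp2r _ _ (ltn0Sn 1)) !expnMn; lia.
rewrite !(expnM _ 2 2); move: (a ^ 2)%N (b ^ 2)%N h2 => c d.
rewrite -(leq_exp2r _ _ (ltn0Sn 1)) !expnMn.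
by move: (c ^ 2)%N (d ^ 2)%N => *; lia.
Qed.

Lemma le_of_approx (I W K : R) (n0 : nat) :
  (forall n, (n0 <= n)%N -> I <= W + K / n.+1%:R) -> I <= W.
Proof.
move=> h; rewrite leNgt; apply/negP => WI; pose d := I - W.
have d0 : 0 < d by rewrite subr_gt0.
pose n := maxn n0 (Num.bound (`|K| / d)).
have := h n (leq_maxl _ _); apply/negP; rewrite -ltNge -ltrBrDl -/d.
rewrite (le_lt_trans (ler_norm _))// normrM [`|_^-1|]gtr0_norm ?invr_gt0//.
rewrite ltr_pdivrMr// mulrC -ltr_pdivrMr//.
apply: lt_le_trans (archi_boundP _) _; first by rewrite divr_ge0// ltW.
by rewrite ler_nat (leq_trans (leq_maxr n0 _)).
Qed.

(** The approximation errors are of order [1/n] for fixed [t] and [j], so they vanish as the depth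
    [n] grows, leaving the mean-square bound of [avg_trig_approx]. *)
Lemma integral_trig_le (t Th : R) (j : nat) :
  let z : R := 2 ^+ j in
  100 <= Th -> z ^+ 35 <= `|t| -> `|t| <= Th * z ^+ 35 ->
  `|\int[mu]_(x in `[0, 1]) cos (t * x)| <= 1000 * Th / z /\
  `|\int[mu]_(x in `[0, 1]) sin (t * x)| <= 1000 * Th / z.
Proof.
move=> z; have zE : z = 2 ^+ j by []. clearbody z; move=> Th1.
have z0 : 0 < z by rewrite zE exprn_gt0.
have Th0 : 0 <= Th by exact: le_trans Th1.
have W0 : 0 <= 1000 * Th / z.
  exact: (divr_ge0 (mulr_ge0 (ler0n R _) Th0) (ltW z0)).
(* One factor [z] pays for [(2 j + 1)^4 <= 1000 z]; then [4 * (125 * 1000 + 1)] is below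
   [1000^2]. *)
have YW : 4 * (125 * Th ^+ 2 * (2 * j).+1%:R ^+ 4 / z ^+ 3 + (z ^+ 2)^-1) <=
    (1000 * Th / z) ^+ 2.
  have zi : 0 < (z ^+ 2)^-1 by rewrite invr_gt0 exprn_gt0.
  have h : (2 * j).+1%:R ^+ 4 / z ^+ 3 <= 1000 / z ^+ 2.
    rewrite [z ^+ 3]exprS invfM mulrA ler_pM2r// ler_pdivrMr//.
    by rewrite zE -!natrX -natrM ler_nat poly4_le_exp2.
  have Th2 : 1 <= Th ^+ 2.
    by rewrite exprn_ege1// (le_trans _ Th1)// ler1n.
  have h1 := ler_wpM2l (le_trans ler01 Th2) h.
  have h2 : (z ^+ 2)^-1 <= Th ^+ 2 * (z ^+ 2)^-1 by rewrite ler_peMl// ltW.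
  have fin (p q r : R) : 0 <= p -> q <= 1000 * p -> r <= p ->
      4 * (125 * q + r) <= 1000 * (1000 * p) by lra.
  have -> : (1000 * Th / z) ^+ 2 = 1000 * (1000 * (Th ^+ 2 * (z ^+ 2)^-1)).
    by rewrite -exprVn; ring.
  rewrite -[125 * _ * _ / _]mulrA -[125 * _ * _]mulrA; apply: fin => //.
    exact: le_trans (ltW zi) h2.
  by apply: (le_trans h1); rewrite mulrCA.
move=> tz tTz.
have tri (I av a e1 e2 W : R) : `|I - av| <= e1 -> `|av - a| <= e2 -> `|a| <= W ->
    `|I| <= W + (e1 + e2).
  move=> h1 h2 h3; rewrite -[I](subrK av) -[X in _ + X](subrK a).
  rewrite (le_trans (ler_normD _ _))// addrCA lerD//.
  by rewrite (le_trans (ler_normD _ _))// addrC lerD.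
have e (K u v : R) : (1 + K) * u / v = u / v + K * (u / v) by ring.
have ct : continuous (fun x => t * x).
  by move=> x; apply: cvgM; [exact: cvg_cst|exact: cvg_id].
have cc : continuous (fun x => cos (t * x)).
  by move=> x; apply: continuous_comp; [exact: ct|exact: continuous_cos].
have cs : continuous (fun x => sin (t * x)).
  by move=> x; apply: continuous_comp; [exact: ct|exact: continuous_sin].
have Lc : lipschitz01 `|t| (fun x => cos (t * x)).
  by move=> x y _ _; rewrite (le_trans (cos_lipschitz _ _))// -mulrBr normrM.
have Ls : lipschitz01 `|t| (fun x => sin (t * x)).
  by move=> x y _ _; rewrite (le_trans (sin_lipschitz _ _))// -mulrBr normrM.
have bc x : `|cos (t * x)| <= 1 by rewrite ler_norml cos_geN1 cos_le1.
have bs x : `|sin (t * x)| <= 1 by rewrite ler_norml sin_geN1 sin_le1.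
have sq a b : a ^+ 2 + b ^+ 2 <=
    4 * (125 * Th ^+ 2 * (2 * j).+1%:R ^+ 4 / z ^+ 3 + (z ^+ 2)^-1) ->
    `|a| <= 1000 * Th / z.
  move=> h; rewrite -ler_sqr ?nnegrE// real_normK ?num_real//.
  by have := sqr_ge0 b; lra.
clear YW W0; rewrite zE in tz tTz sq *.
split; apply: (@le_of_approx _ _ ((1 + (2 ^ (7 * j))%:R) * `|t|) (17 * j)) => n jn;
  have [a [b [ha hb hab]]] := avg_trig_approx Th1 tz tTz jn.
- rewrite (e (2 ^ (7 * j))%:R `|t| n.+1%:R).
  exact: tri (integral_avg_near n Lc cc bc (normr_ge0 t)) ha (sq _ _ hab).
- have hba : `|b| <= 1000 * Th / 2 ^+ j by apply: (sq b a); rewrite [leLHS]addrC.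
  rewrite (e (2 ^ (7 * j))%:R `|t| n.+1%:R).
  exact: tri (integral_avg_near n Ls cs bs (normr_ge0 t)) hb hba.
Qed.

Lemma exists_pow2_scale (t : R) (k : nat) : (0 < k)%N -> 1 <= t ->
  exists j : nat, (2 ^+ j) ^+ k <= t /\ t < (2 ^+ j.+1) ^+ k.
Proof.
move=> k0 t1.
have ex : exists m : nat, t < (2 ^+ m) ^+ k.
  exists (Num.bound t); apply: lt_le_trans (archi_boundP (le_trans ler01 t1)) _.
  apply: (@le_trans _ _ (2 ^+ Num.bound t)).
    by rewrite -natrX ler_nat ltnW// ltn_expl.
  by rewrite ler_eXnr// exprn_ege1// ler1n.
case: (ex_minnP ex) => [] [|j]; first by rewrite expr0 expr1n ltNge t1.
move=> tj minj; exists j; split => //.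
by rewrite leNgt; apply/negP => /minj; rewrite ltnn.
Qed.

Lemma normc_le_abs (a b : R) : Normc.normc (Complex a b) <= `|a| + `|b|.
Proof.
rewrite /= -[leRHS]ger0_norm ?addr_ge0// -sqrtr_sqr ler_wsqrtr//.
rewrite sqrrD !real_normK ?num_real// -addrA lerD2l.
by rewrite lerDr mulrn_wge0// mulr_ge0.
Qed.

End final.

Theorem theorem2 (R : realType) :
  exists C T0 : R, [/\ 0 < C, 0 < T0 &
    forall t : R, T0 <= `|t| ->
      Normc.normc (minkowski_m t) <= C * `|t| `^ (- 35^-1)].
Proof.
(* The ratio of consecutive scales [(2^j)^35]; it is introduced abstractly so that the power stays
   folded. *)
have [Th ThE] : exists Th : R, Th = 2 ^+ 35 by exists (2 ^+ 35).
have Th0 : 0 < Th by rewrite ThE exprn_gt0.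
have [K KE] : exists K : R, K = 1000 * Th by exists (1000 * Th).
have K0 : 0 < K by rewrite KE pmulr_rgt0 ?(ltr0n R 1000).
have C0 : 0 < 4 * K by rewrite mulr_gt0.
exists (4 * K), 1; split => // t t1.
have [j [zt tz]] := @exists_pow2_scale R `|t| 35 isT t1.
have Th1 : 100 <= Th.
  apply: (@le_trans _ _ (2 ^+ 7)); first by rewrite -natrX ler_nat.
  by rewrite ThE ler_weXn2l// ler1n.
have tTz : `|t| <= Th * (2 ^+ j) ^+ 35 by rewrite ltW// ThE -exprMn -exprS.
have [hc hs] := integral_trig_le Th1 zt tTz.
have z0 : 0 < 2 ^+ j :> R by rewrite exprn_gt0.
have -> : minkowski_m t =
    Complex (\int[lebesgue_stieltjes_measure (@minkowski_cdf R)]_(x in `[0, 1]) cos (t * x))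
            (\int[lebesgue_stieltjes_measure (@minkowski_cdf R)]_(x in `[0, 1]) sin (t * x)).
  by rewrite /minkowski_m /Cintegral; congr Complex; apply: eq_Rintegral => x _;
    rewrite /= mulrC.
apply: (le_trans (normc_le_abs _ _)); apply: (le_trans (lerD hc hs)); rewrite -KE.
have p0 : 0 < `|t| `^ 35^-1 by rewrite powR_gt0// (lt_le_trans ltr01 t1).
(* The upper end of the scale, [|t| < (2^(j+1))^35], is what converts [1 / 2^j] into a power of
   [|t|]; the shift from [j] to [j+1] doubles the constant. *)
have h : `|t| `^ 35^-1 <= 2 ^+ j.+1.
  have pw (a : R) : 0 <= a -> (a ^+ 35) `^ 35^-1 = a.
    by move=> a0; rewrite -powR_mulrn// -powRrM mulfV ?pnatr_eq0// powRr1.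
  rewrite -[leRHS]pw ?exprn_ge0//.
  by rewrite ge0_ler_powR ?nnegrE ?exprn_ge0 ?invr_ge0// ltW.
rewrite powRN.
have -> : K / 2 ^+ j + K / 2 ^+ j = 4 * K / 2 ^+ j.+1.
  by rewrite exprS; field; rewrite lt0r_neq0.
by rewrite ler_wpM2l ?(ltW C0)// lef_pV2 ?posrE// exprn_gt0.
Qed.
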